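(* Suppose $r_1,\ldots,r_m\in\mathbb{C}^n$ are independent random vectors. Then, for every $k$, $$\lambda_k\left(\sum_{i=1}^m r_ir_i^*\right)\le \lambda_k\left(\mathbb{E}\,\chi\left[\sum_{i=1}^m r_ir_i^*\right](x)\right)$$ with positive probability, and the same is true with $\ge$ instead of $\le$.
   Context: For a square matrix $M$, $\chi[M](x)=\det(xI-M)$ is its characteristic polynomial in the variable $x$. The expectation of a random polynomial is taken coefficientwise. $\lambda_1\ge\lambda_2\ge\cdots\ge\lambda_n$ denote the eigenvalues of an $n\times n$ Hermitian matrix, and likewise the roots of a real-rooted polynomial of degree $n$, so that $\lambda_k$ is the $k$-th largest eigenvalue or root. $r_i^*$ is the conjugate transpose of the column vector $r_i$. *)

(* Defs.v *)
From HB Require Import structures.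
From mathcomp Require Import all_boot all_order all_algebra.
From mathcomp Require Import spectral complex.
From mathcomp Require Import all_classical all_reals all_analysis.

Set Implicit Arguments.
Unset Strict Implicit.
Unset Printing Implicit Defensive.

Import Order.TTheory GRing.Theory Num.Theory.
Local Open Scope classical_set_scope.
Local Open Scope ring_scope.
Local Open Scope complex_scope.
Local Open Scope sesquilinear_scope.

Definition poly_roots (F : closedFieldType) (p : {poly F}) : seq F :=
  sval (closed_field_poly_normal p).

Definition real_rooted (R : rcfType) (p : {poly R[i]}) : Prop :=
  forall z, root p z -> z \is Num.real.

(* Indices start at 1: [root_rank 1 p] is the largest root. The real part only
   retypes the roots, as this is meant for real-rooted [p]; [root_rank k p] is
   a junk value unless 1 <= k <= deg p. *)
Definition root_rank (R : rcfType) (k : nat) (p : {poly R[i]}) : R :=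
  nth 0 (sort >=%R [seq complex.Re z | z <- poly_roots p]) k.-1.

Definition eigenvalue_rank (R : rcfType) (k n : nat) (M : 'M[R[i]]_n) : R :=
  root_rank k (char_poly M).

Definition sum_outer (R : rcfType) (m n : nat) (v : 'I_m -> 'cV[R[i]]_n) :
    'M[R[i]]_n :=
  \sum_(i < m) v i *m (v i)^t*.

(* The Borel sigma-algebra of C^n = R^(2n), generated by the real and
   imaginary parts of the coordinates. *)
Definition borel_cvec (R : realType) (n : nat) : set (set 'cV[R[i]]_n) :=
  <<s \bigcup_(j in [set: 'I_n])
        (preimage_set_system setT
           (fun v : 'cV[R[i]]_n => complex.Re (v j 0)) measurable `|`
         preimage_set_system setT
           (fun v : 'cV[R[i]]_n => complex.Im (v j 0)) measurable) >>.
Arguments borel_cvec : clear implicits.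

Definition random_vector (R : realType) (n : nat) (d : measure_display)
    (T : measurableType d) (X : T -> 'cV[R[i]]_n) : Prop :=
  forall A, borel_cvec R n A -> measurable (X @^-1` A).

Definition independent_vectors (R : realType) (m n : nat)
    (d : measure_display) (T : measurableType d) (P : probability T R)
    (X : 'I_m -> T -> 'cV[R[i]]_n) : Prop :=
  forall (J : {set 'I_m}) (A : 'I_m -> set 'cV[R[i]]_n),
    (forall i, borel_cvec R n (A i)) ->
    P (\bigcap_(i in [set` J]) (X i @^-1` A i)) =
    (\prod_(i in J) P (X i @^-1` A i))%E.

Definition complex_integrable (R : realType) (d : measure_display)
    (T : measurableType d) (P : probability T R) (Z : T -> R[i]) : Prop :=
  P.-integrable setT (EFin \o (fun w => complex.Re (Z w))) /\
  P.-integrable setT (EFin \o (fun w => complex.Im (Z w))).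

Definition complex_expectation (R : realType) (d : measure_display)
    (T : measurableType d) (P : probability T R) (Z : T -> R[i]) : R[i] :=
  (fine 'E_P[fun w => complex.Re (Z w)]) +i*
  (fine 'E_P[fun w => complex.Im (Z w)]).

Definition poly_integrable (R : realType) (d : measure_display)
    (T : measurableType d) (P : probability T R) (p : T -> {poly R[i]}) : Prop :=
  forall j : nat, complex_integrable P (fun w => (p w)`_j).

(* Meant for random polynomials of degree at most [n]. *)
Definition poly_expectation (R : realType) (d : measure_display)
    (T : measurableType d) (P : probability T R) (n : nat)
    (p : T -> {poly R[i]}) : {poly R[i]} :=
  \poly_(j < n.+1) complex_expectation P (fun w => (p w)`_j).

(* Main.v *)
Require Import Defs.
From HB Require Import structures.
From mathcomp Require Import all_boot all_order all_algebra.
From mathcomp Require Import spectral complex polyrcf.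
From mathcomp Require Import all_classical all_reals all_analysis.
From mathcomp Require Import perm measurable_realfun.
From mathcomp Require Import ring lra zify.

Set Implicit Arguments.
Unset Strict Implicit.
Unset Printing Implicit Defensive.

Import Order.TTheory GRing.Theory Num.Theory.
Local Open Scope classical_set_scope.
Local Open Scope ring_scope.
Local Open Scope complex_scope.

(** Write [outer v] for the product of [v] and its conjugate transpose, and let
    [F_j (C)] be the expectation of the characteristic polynomial of [C] plus the
    rank-one terms [outer r_i] with [i >= j], as a function of the matrix [C].
    So [F_m (C)] is the characteristic polynomial of [C], the average of
    [F_(j+1) (C + outer r_j)] over [r_j] is [F_j (C)], and [F_0 (0)] is the
    polynomial [q] of the theorem ([poly_expectation_mean]).

    Each [F_j] is stable: [F_j (C)] does not vanish at [z] when [z - C] has a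
    positive definite imaginary part.  For the characteristic polynomial this is
    the invertibility of such matrices.  It passes from [F = F_(j+1)] to its
    average because [F (C + t (outer v))] is affine in [t]: its value at [z] is
    [F (C) (1 - t rho)], nonzero whenever [Im t <= 0], so that [rho] is zero or
    has negative imaginary part.  A mean of such numbers is never [1], hence the
    averaged polynomial does not vanish either ([admissible_average]).  For
    Hermitian [C], stability says that [F_j (C)] is real-rooted.

    The same computation shows that both [F (C + outer v)] and the average of [F]
    at [C], divided by [F (C)], map the upper half-plane to the closed upper
    half-plane.  Locally at a real point such a quotient can only have a simple
    zero, a simple pole, or neither, with a sign constraint, and it follows that
    the number of roots above a threshold exceeds that of [F (C)] by zero or one
    ([interlacing_count]).  Thus, among the polynomials [F (C + outer r_j)] and
    their average, the number of roots above a threshold is determined by its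
    parity, that is by the sign of the polynomial right next to the threshold.
    This sign is that of the first nonzero Taylor coefficient, and a mean cannot
    have a sign that is almost surely not taken.  So with positive probability
    [F (C + outer r_j)] has exactly as many roots above the threshold as its
    average ([prob_nroots_average]).

    Drawing the vectors one after the other, independence and Fubini show that
    with positive probability the characteristic polynomial of the sum has as
    many roots above a threshold as [q] has ([prob_nroots_mean]).  With the k-th
    root of [q] as threshold, counting the roots [> c] gives the inequality [<=]
    and counting the roots [>= c] gives [>=]. *)

(** * The sign of a polynomial next to a point *)

Section Germs.
Variable R : realType.
Implicit Types (p q : {poly R}) (b : bool) (c x : R) (s t : seq R).

(** The flag [b] selects one of the two root counts at [c]: the roots [> c]
    decide whether the k-th root is at most [c], the roots [>= c] whether it is
    at least [c].  Both inequalities of the theorem are proved at once. *)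
Definition above b c x := if b then c <= x else c < x.

(** Positivity on a right neighbourhood of [0], read off the lowest nonzero
    coefficient.  This algebraic form is a countable combination of sign
    conditions on the coefficients, hence measurable, and it passes through
    expectations. *)
Definition pos_germ p :=
  exists i, (forall j, (j < i)%N -> p`_j = 0) /\ 0 < p`_i.

(** Sends the right side of [c] ([b = false]) or its left side ([b = true]) to
    the right side of [0], so that the germ of [p] at [c], on the side matching
    [above b], becomes a germ at [0+]. *)
Definition recenter b c p := p \Po (c%:P + (-1) ^+ b *: 'X).

Lemma pos_germM p q : pos_germ p -> pos_germ q -> pos_germ (p * q).
Proof.
move=> [i [pi0 pi]] [j [qj0 qj]]; exists (i + j)%N; split.
  move=> k kij; rewrite coefM big1 // => l _.
  case: (ltnP l i) => [/pi0 ->|il]; first by rewrite mul0r.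
  rewrite qj0 ?mulr0 //; have := ltn_ord l; lia.
have hi : (i < (i + j).+1)%N by lia.
rewrite coefM (bigD1 (Ordinal hi)) //= big1 ?addr0.
  by rewrite addKn mulr_gt0.
move=> l /eqP li; case: (ltnP l i) => [/pi0 ->|il]; first by rewrite mul0r.
rewrite qj0 ?mulr0 //.
have : (l : nat) <> i by move=> e; apply: li; apply: val_inj.
by have := ltn_ord l; lia.
Qed.

Lemma pos_germ_opp p : pos_germ p -> ~ pos_germ (- p).
Proof.
move=> [i [pi0 pi]] [j []]; rewrite coefN oppr_gt0 => pj0 pj.
case: (ltngtP i j) => [ij|ji|ij].
- by move: (pj0 _ ij); rewrite coefN => /eqP; rewrite oppr_eq0 gt_eqF.
- by move: pj; rewrite pi0 // ltxx.
- by move: pj; rewrite -ij ltNge ltW.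
Qed.

Lemma pos_germ_factor b c x :
  pos_germ ((-1) ^+ above b c x *: recenter b c ('X - x%:P)).
Proof.
have -> : (-1) ^+ above b c x *: recenter b c ('X - x%:P) =
   ((-1) ^+ above b c x * (c - x))%:P + ((-1) ^+ above b c x * (-1) ^+ b) *: 'X.
  rewrite /recenter comp_polyB comp_polyX comp_polyC addrAC -polyCB.
  by rewrite scalerDr scalerA polyCM mul_polyC.
case: (ltgtP c x) => cx.
- exists 0%N; split=> //; rewrite coefD coefC coefZ coefX mulr0 addr0 /=.
  have -> : above b c x = true by rewrite /above; case: b; rewrite ?cx ?ltW.
  by rewrite expr1 mulN1r opprB subr_gt0.
- exists 0%N; split=> //; rewrite coefD coefC coefZ coefX mulr0 addr0 /=.
  have -> : above b c x = false.
    by rewrite /above; case: b; rewrite ?lt_geF// ?le_gtF ?ltW.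
  by rewrite expr0 mul1r subr_gt0.
- exists 1%N; split.
    move=> [|j] // _; rewrite coefD coefC coefZ coefX mulr0 addr0 /=.
    by rewrite cx subrr mulr0.
  rewrite coefD coefC coefZ coefX mulr1 add0r.
  have -> : above b c x = b by rewrite /above cx lexx ltxx; case: b.
  by rewrite -exprMn mulrNN mulr1 expr1n.
Qed.

(** Each linear factor contributes its own sign on the chosen side of [c], and
    this sign is negative exactly for the roots that are counted. *)
Lemma pos_germ_prod b c s :
  pos_germ ((-1) ^+ count (above b c) s *:
    recenter b c (\prod_(x <- s) ('X - x%:P))).
Proof.
elim: s => [|x s IH].
  rewrite big_nil expr0 scale1r /recenter comp_polyC.
  by exists 0%N; split=> //; rewrite coefC /= ltr01.
rewrite big_cons /recenter comp_polyM /= exprD -scalerA.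
have -> : forall (u v : R) p q, u *: (v *: (p * q)) = (u *: p) * (v *: q).
  by move=> u v p q; rewrite -scalerAl -scalerAr.
exact: pos_germM (pos_germ_factor b c x) IH.
Qed.

End Germs.

(** * Interlacing of real roots *)

Section LocalInterlacing.
Variable R : realType.
Implicit Types (p q : {poly R}) (b : bool) (c x : R) (s t : seq R).

Lemma ge0_horner_at0 p : (forall e, 0 < e -> 0 <= p.[e]) -> 0 <= p.[0].
Proof.
move=> pos; rewrite leNgt; apply/negP => p0.
have [|d d0 Hd] := @poly_cont _ 0 p (- p.[0]); first by rewrite oppr_gt0.
have := Hd (d / 2); rewrite subr0 gtr0_norm ?divr_gt0 // ltr_pdivrMr //.
rewrite ltr_pMr // ltr1n => /(_ isT); rewrite ltr_norml => /andP[_].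
have := pos (d / 2); rewrite divr_gt0 // => /(_ isT); lra.
Qed.

Definition expi (th : R) : R[i] := cos th +i* sin th.

Lemma expiD x y : expi (x + y) = expi x * expi y.
Proof. by rewrite /expi cosD sinD; simpc; rewrite [cos x * sin y + _]addrC. Qed.

Lemma expi_exp (th : R) (k : nat) : expi th ^+ k = expi (k%:R * th).
Proof.
elim: k => [|k IH]; first by rewrite mul0r expr0 /expi cos0 sin0.
by rewrite exprS IH -expiD -{1}[th]mul1r -mulrDl -natr1 addrC.
Qed.

Lemma conjc_expi (th : R) : conjc (expi th) = expi (- th).
Proof. by rewrite /expi cosN sinN. Qed.

Lemma Im_expi_quot (th : R) (k l : nat) :
  complex.Im (expi th ^+ k * conjc (expi th) ^+ l) = sin ((k%:R - l%:R) * th).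
Proof. by rewrite conjc_expi !expi_exp -expiD mulrN -mulrBl. Qed.

Lemma horner_map_Im (p : {poly R[i]}) x :
  (map_poly (@complex.Im R) p).[x] = complex.Im p.[x%:C].
Proof.
have szp : (size (map_poly (@complex.Im R) p) <= size p)%N by exact: size_poly.
rewrite (horner_coef_wide _ szp) horner_coef.
rewrite (big_morph (@complex.Im R) (id1 := 0) (op1 := +%R)) //; last first.
  by move=> [? ?] [? ?].
apply: eq_bigr => i _; rewrite coef_map_id0 //.
by rewrite -rmorphXn /=; case: (p`_i) => u v; simpc.
Qed.

Definition linprod s (z : R[i]) : R[i] := \prod_(x <- s) (z - x%:C).

Lemma linprod_split c s z :
  linprod s z = (z - c%:C) ^+ count_mem c s * \prod_(x <- s | x != c) (z - x%:C).
Proof.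
rewrite /linprod (bigID (xpred1 c)) /=; congr (_ * _).
rewrite (eq_bigr (fun=> z - c%:C)) => [|x /eqP -> //].
by rewrite big_const_seq iter_mulr_1.
Qed.

Lemma pos_germ_count c s :
  0 < (-1) ^+ count (above false c) s * \prod_(x <- s | x != c) (c - x).
Proof.
elim: s => [|x s IH]; first by rewrite big_nil mulr1 expr0 ltr01.
rewrite big_cons /= exprD {1}/above; case: (ltgtP c x) => cx /=.
- by rewrite mulrACA mulr_gt0 // expr1 mulN1r opprB subr_gt0.
- by rewrite expr0 mul1r mulrCA mulr_gt0 // subr_gt0.
- by rewrite expr0 mul1r.
Qed.

(** Write [g] and [f] for the polynomials with roots [t] and [s].  Near [c] the
    quotient [g / f] behaves like [kap' * (z - c) ^ (k - l)], where [kap'] is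
    real with the sign of [kap].  Approaching [c] along the ray of angle [th],
    the nonnegativity of the imaginary part becomes a condition on
    [sin ((k - l) * th)]. *)
Lemma interlacing_local s t c (k := count_mem c t) (l := count_mem c s)
    (kap := \prod_(x <- t | x != c) (c - x) * \prod_(x <- s | x != c) (c - x)) :
  (forall z, 0 < complex.Im z ->
     0 <= complex.Im (linprod t z * conjc (linprod s z))) ->
  forall th, 0 < th < pi -> 0 <= sin ((k%:R - l%:R) * th) * kap.
Proof.
move=> pos th th0; set w := expi th.
(* Up to the factor [e ^ (k + l)], the imaginary part at the point [c + e * w] is
   the value at [e] of the real polynomial [u], and [u] at [0] is the claim. *)
pose fac (w : R[i]) x : {poly R[i]} := w *: 'X + ((c - x)%:C)%:P.
pose P := \prod_(x <- t | x != c) fac w x * \prod_(x <- s | x != c) fac (conjc w) x.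
pose u := map_poly (@complex.Im R) ((w ^+ k * conjc w ^+ l) *: P).
have hfac v (e : R) (r : seq R) :
    (\prod_(x <- r | x != c) fac v x).[e%:C] =
    \prod_(x <- r | x != c) (c%:C + e%:C * v - x%:C).
  rewrite horner_prod; apply: eq_bigr => x _.
  by rewrite /fac !hornerE rmorphB /= mulrC; ring.
suff: 0 <= u.[0].
  rewrite horner_map_Im hornerZ /P hornerM !hfac rmorph0 !mul0r addr0.
  have rp r : \prod_(x <- r | x != c) (c%:C - x%:C) =
              (\prod_(x <- r | x != c) (c - x))%:C :> R[i].
    by rewrite rmorph_prod /=; apply: eq_bigr => x _; rewrite rmorphB.
  rewrite !rp -rmorphM -/kap -Im_expi_quot -/w.
  by case: (w ^+ k * _) => x y; simpc.
apply: ge0_horner_at0 => e e0.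
have := pos (c%:C + e%:C * w).
have -> : complex.Im (c%:C + e%:C * w) = e * sin th by rewrite /w /expi; simpc.
rewrite mulr_gt0 ?sin_gt0_pi // => /(_ isT).
rewrite (linprod_split c t) (linprod_split c s) addrAC subrr add0r.
rewrite !exprMn !rmorphM rmorph_prod /= !rmorphXn /=.
have -> : \prod_(x <- s | x != c) conjc (c%:C + e%:C * w - x%:C) =
          \prod_(x <- s | x != c) (c%:C + e%:C * conjc w - x%:C).
  by apply: eq_bigr => x _; rewrite rmorphB rmorphD rmorphM /= !oppr0.
rewrite horner_map_Im hornerZ /P hornerM !hfac /= !oppr0 -/k -/l.
set A := \prod_(x <- t | _) _; set B := \prod_(x <- s | _) _.
have -> : e%:C ^+ k * w ^+ k * A * (e%:C ^+ l * conjc w ^+ l * B) =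
   (e ^+ (k + l))%:C * (w ^+ k * conjc w ^+ l * (A * B)).
  by rewrite rmorphXn exprD /=; ring.
case: (_ * (A * B)) => x y; simpc.
by rewrite pmulr_rge0 // exprn_gt0.
Qed.

End LocalInterlacing.

Section Interlacing.
Variable R : realType.
Implicit Types (p q : {poly R}) (b : bool) (c x : R) (s t : seq R).

(** If [E >= 2], the angles [pi / (2 E)] and [3 pi / (2 E)] both lie in
    [(0, pi)] and give the sine the opposite values [1] and [-1]. *)
Lemma sin_frequency (E : nat) (kap : R) : (0 < E)%N -> kap != 0 ->
  (forall th, 0 < th < pi -> 0 <= sin (E%:R * th) * kap) ->
  E = 1%N /\ 0 < kap.
Proof.
move=> E0 kap0 H; have pi0 := @pi_gt0 R.
have ER : 0 < E%:R :> R by rewrite ltr0n.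
have E1 : 1 <= E%:R :> R by rewrite ler1n.
have k0 : 0 < kap.
  have := H (pi / 2 / E%:R); rewrite [E%:R * _]mulrCA divff ?gt_eqF // mulr1 sin_pihalf mul1r.
  move=> Hk; rewrite lt_def kap0 /=; apply: Hk.
  rewrite !divr_gt0 //= ltr_pdivrMr //; nra.
split=> //; apply/eqP; rewrite eqn_leq E0 andbT leqNgt; apply/negP => E2.
have ER2 : 2 <= E%:R :> R by rewrite (ler_nat R 2).
have := H (3 * (pi / 2) / E%:R); rewrite [E%:R * _]mulrCA divff ?gt_eqF // mulr1.
have -> : 3 * (pi / 2) = pi / 2 + pi :> R by field.
rewrite sinDpi sin_pihalf mulN1r oppr_ge0 => Hk.
have : kap <= 0 by apply: Hk; rewrite ltr_pdivrMr // divr_gt0 //=; nra.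
by rewrite leNgt k0.
Qed.

Variables s t : seq R.
Hypothesis pos : forall z, 0 < complex.Im z ->
  0 <= complex.Im (linprod t z * conjc (linprod s z)).

(** Passing [c] from right to left changes the difference of the two root counts
    by at most one, upwards only from an even value and downwards only from an
    odd value. *)
Lemma interlacing_jump c :
  let D r := count (above false c) r in
  [\/ count_mem c t = count_mem c s,
      count_mem c t = (count_mem c s).+1 /\ odd (D t) = odd (D s) |
      count_mem c s = (count_mem c t).+1 /\ odd (D t) <> odd (D s)].
Proof.
move=> D; have := interlacing_local c pos.
set k := count_mem c t; set l := count_mem c s.
set A := \prod_(x <- t | _) _; set B := \prod_(x <- s | _) _ => H.
have : 0 < (-1) ^+ (D t + D s) * (A * B).
  by rewrite exprD mulrACA mulr_gt0 // pos_germ_count.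
rewrite -signr_odd oddD => par.
have AB0 : A * B != 0 by apply/eqP => AB0; rewrite AB0 mulr0 ltxx in par.
case: (ltngtP k l) => kl; last by constructor 1.
- have [| ||lk1 AB] := @sin_frequency (l - k) (- (A * B)).
  + by rewrite subn_gt0.
  + by rewrite oppr_eq0.
  + move=> th /H; rewrite natrB ?(ltnW kl) // -[_ - k%:R]opprB mulNr sinN.
    by rewrite mulrNN.
  constructor 3; split; first lia.
  by move=> e; move: par; rewrite e addbb expr0 mul1r => par; rewrite oppr_gt0 ltNge ltW in AB.
- have [| ||lk1 AB] := @sin_frequency (k - l) (A * B) => //.
  + by rewrite subn_gt0.
  + by move=> th /H; rewrite natrB ?(ltnW kl).
  constructor 2; split; first lia.
  by case: (odd (D t)) par; case: (odd (D s)) => //=;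
    rewrite expr1 mulN1r oppr_gt0 ltNge ltW.
Qed.

Lemma count_aboveT c (r : seq R) :
  count (above true c) r = (count (above false c) r + count_mem c r)%N.
Proof.
elim: r => //= x r ->; rewrite /above le_eqVlt eq_sym; case: ltgtP => //=; lia.
Qed.

Lemma seq_has_min (r : seq R) : r != [::] ->
  exists2 x, x \in r & forall y, y \in r -> x <= y.
Proof.
elim: r => // x r IH _; case: (eqVneq r [::]) => [->|/IH [y yr ymin]].
  by exists x; rewrite ?mem_head // => y; rewrite inE => /eqP ->.
exists (Num.min x y).
  by rewrite inE minEle; case: ifP; rewrite ?eqxx // yr orbT.
move=> z; rewrite inE ge_min => /orP[/eqP ->|/ymin ->]; rewrite ?lexx ?orbT //.
Qed.

(** The difference of the root counts vanishes to the right of all roots, and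
    by [interlacing_jump] it can then only alternate between [0] and [1].  The
    induction moves [c] to the next root on its right. *)
Lemma interlacing_count b c :
  (count (above b c) s <= count (above b c) t <= (count (above b c) s).+1)%N.
Proof.
have step c' :
    (count (above false c') s <= count (above false c') t <=
      (count (above false c') s).+1)%N ->
    (count (above true c') s <= count (above true c') t <=
      (count (above true c') s).+1)%N.
  move=> /andP[le1 le2]; rewrite !count_aboveT; apply/andP.
  have [->|[-> par]|[-> par]] := interlacing_jump c'.
  - by split; lia.
  - suff : count (above false c') t <> (count (above false c') s).+1 by split; lia.
    by move=> e; move: par; rewrite e /=; case: (odd _).
  - suff : count (above false c') t <> count (above false c') s by split; lia.
    by move=> e; apply: par; rewrite e.
suff {b} H : forall N c', (size (seq.filter (above false c') (s ++ t)) <= N)%N ->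
    (count (above false c') s <= count (above false c') t <=
      (count (above false c') s).+1)%N.
  by case: b; [apply: step|]; exact: H (leqnn _).
elim=> [|N IH] {}c.
  by rewrite filter_cat size_cat !size_filter; lia.
move=> szN; case: (eqVneq (seq.filter (above false c) (s ++ t)) [::]) => [e|].
  by have := congr1 size e; rewrite filter_cat size_cat !size_filter /=; lia.
move=> /seq_has_min[d]; rewrite mem_filter => /andP[cd dst] dmin.
have cnt r : {subset r <= s ++ t} -> count (above false c) r = count (above true d) r.
  move=> sub; apply: eq_in_count => x /sub xst; rewrite /above.
  apply/idP/idP => [cx|]; last exact: lt_le_trans.
  by apply: dmin; rewrite mem_filter xst andbT.
rewrite (cnt s) 1?(cnt t); first 1 last.
- by move=> x xt; rewrite mem_cat xt orbT.
- by move=> x xs; rewrite mem_cat xs.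
apply: step; apply: IH; rewrite -ltnS; apply: leq_trans szN.
rewrite !size_filter (cnt _ (fun _ => id)) count_aboveT -addn1 leq_add2l.
by rewrite -has_count has_pred1.
Qed.

End Interlacing.

(** * Real-rooted monic polynomials *)

Section RealRooted.
Variable R : realType.
Implicit Types (p q : {poly R[i]}) (b : bool) (c : R).

Definition real_roots p : seq R := [seq complex.Re z | z <- poly_roots p].

Definition nroots b c p : nat := count (above b c) (real_roots p).

Definition Re_poly p : {poly R} := map_poly (@complex.Re R) p.

Lemma monic_poly_roots p : p \is monic -> p = \prod_(z <- poly_roots p) ('X - z%:P).
Proof.
move=> /monicP lp; rewrite /poly_roots; case: closed_field_poly_normal => r /= e.
by rewrite {1}e lp scale1r.
Qed.

Lemma size_real_roots p : p \is monic -> size (real_roots p) = (size p).-1.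
Proof.
by move=> /monic_poly_roots e; rewrite {2}e size_prod_XsubC /real_roots size_map.
Qed.

Lemma real_rooted_prod p : p \is monic -> real_rooted p ->
  p = map_poly (real_complex R) (\prod_(x <- real_roots p) ('X - x%:P)).
Proof.
move=> mp rr; rewrite {1}(monic_poly_roots mp) rmorph_prod /= big_map.
apply: eq_big_seq => z zp; rewrite rmorphB /= map_polyX map_polyC /=.
suff zR : z \is Num.real by rewrite (RRe_real zR).
apply: rr; rewrite (monic_poly_roots mp).
by rewrite root_prod_XsubC.
Qed.

Lemma Re_poly_real (p : {poly R}) : Re_poly (map_poly (real_complex R) p) = p.
Proof. by apply/polyP => i; rewrite coef_map_id0 // coef_map. Qed.

Lemma horner_real_rooted p z : p \is monic -> real_rooted p ->
  p.[z] = linprod (real_roots p) z.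
Proof.
move=> mp rr; rewrite {1}(real_rooted_prod mp rr) rmorph_prod horner_prod.
by apply: eq_bigr => x _; rewrite rmorphB /= map_polyX map_polyC /= !hornerE.
Qed.

Lemma pos_germ_nroots b c p : p \is monic -> real_rooted p ->
  pos_germ ((-1) ^+ nroots b c p *: recenter b c (Re_poly p)).
Proof.
move=> mp rr; rewrite {2}(real_rooted_prod mp rr) Re_poly_real.
exact: pos_germ_prod.
Qed.

Lemma nroots_interlacing b c p q : p \is monic -> q \is monic ->
  real_rooted p -> real_rooted q ->
  (forall z, 0 < complex.Im z -> 0 <= complex.Im (q.[z] * conjc p.[z])) ->
  (nroots b c p <= nroots b c q <= (nroots b c p).+1)%N.
Proof.
move=> mp mq rp rq pos; apply: interlacing_count => z /pos.
by rewrite (horner_real_rooted z mp rp) (horner_real_rooted z mq rq).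
Qed.

(** For a polynomial with real coefficients the nonreal roots come in conjugate
    pairs, so excluding the upper half-plane excludes them all. *)
Lemma real_rooted_upper p : map_poly conjc p = p ->
  (forall z, 0 < complex.Im z -> p.[z] != 0) -> real_rooted p.
Proof.
move=> cp up z rz.
have rz' : root p (conjc z) by rewrite -complex_root_conj cp.
case: z rz rz' => x y rz rz'; rewrite complex_real /=.
case: (ltgtP y 0) => // y0.
- by rewrite -oppr_gt0 in y0; move: (up (x -i* y) y0) => /negP[].
- by move: (up (x +i* y) y0) => /negP[].
Qed.

(** In a decreasing sequence the elements satisfying an upward closed predicate
    form an initial segment. *)
Lemma nth_sorted_upset (P : pred R) (u : seq R) i :
  (forall x y, x <= y -> P x -> P y) -> sorted >=%R u -> (i < size u)%N ->
  P (nth 0 u i) = (i < count P u)%N.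
Proof.
move=> up; elim: u i => // x u IH i /= pu iu.
have su : sorted >=%R u by exact: path_sorted pu.
case Px: (P x).
  by case: i iu => [|i] iu //=; rewrite IH.
have nP : forall y, y \in u -> P y = false.
  move=> y yu; apply/negP => Py; move/negP: Px; apply; apply: up Py.
  have : all (>=%R x) u by apply: order_path_min pu => ? ? ? ? /le_trans; apply.
  by move/allP; apply.
have -> : count P u = 0%N by apply/eqP; rewrite -leqn0 leqNgt -has_count; apply/hasPn => y /nP ->.
rewrite ltn0; case: i iu => [|i] iu //=.
by apply: nP; exact: mem_nth.
Qed.

(** The roots satisfying [above b c] are the largest ones, so the k-th largest
    root satisfies it exactly when at least [k] roots do. *)
Lemma above_root_rank b c p k : p \is monic -> (1 <= k <= (size p).-1)%N ->
  above b c (root_rank k p) = (k <= nroots b c p)%N.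
Proof.
move=> mp /andP[k1 kn]; rewrite /root_rank nth_sorted_upset.
- rewrite prednK // /nroots /real_roots.
  by congr leq; apply/seq.permP; rewrite perm_sort.
- by move=> x y xy; rewrite /above; case: b => cx; [exact: le_trans xy|exact: lt_le_trans xy].
- by apply: sort_sorted => x y; exact: le_total.
- by rewrite size_sort size_real_roots // prednK.
Qed.

End RealRooted.

(** * Complex random variables *)

Section ComplexMeasurable.
Variables (R : realType) (d : measure_display) (T : measurableType d).
Implicit Types (Z W : T -> R[i]).

Definition cmeas Z :=
  measurable_fun setT (fun w => complex.Re (Z w)) /\
  measurable_fun setT (fun w => complex.Im (Z w)).

Lemma eq_cmeas Z W : Z =1 W -> cmeas Z -> cmeas W.
Proof. by move=> /funext ->. Qed.

Lemma cmeas_cst a : cmeas (fun=> a).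
Proof. by split; exact: measurable_cst. Qed.

Lemma cmeasD Z W : cmeas Z -> cmeas W -> cmeas (fun w => Z w + W w).
Proof.
move=> [Z1 Z2] [W1 W2]; split.
  rewrite (_ : (fun _ => _) = (fun w => complex.Re (Z w) + complex.Re (W w))).
    exact: measurable_funD.
  by apply/funext => w; case: (Z w) (W w) => ? ? [].
rewrite (_ : (fun _ => _) = (fun w => complex.Im (Z w) + complex.Im (W w))).
  exact: measurable_funD.
by apply/funext => w; case: (Z w) (W w) => ? ? [].
Qed.

Lemma cmeasM Z W : cmeas Z -> cmeas W -> cmeas (fun w => Z w * W w).
Proof.
move=> [Z1 Z2] [W1 W2]; split.
  rewrite (_ : (fun _ => _) = (fun w => complex.Re (Z w) * complex.Re (W w)
     - complex.Im (Z w) * complex.Im (W w))).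
    by apply: measurable_funB; exact: measurable_funM.
  by apply/funext => w; case: (Z w) (W w) => ? ? [].
rewrite (_ : (fun _ => _) = (fun w => complex.Re (Z w) * complex.Im (W w)
     + complex.Im (Z w) * complex.Re (W w))).
  by apply: measurable_funD; exact: measurable_funM.
by apply/funext => w; case: (Z w) (W w) => ? ? [].
Qed.

Lemma cmeas_conj Z : cmeas Z -> cmeas (fun w => conjc (Z w)).
Proof.
move=> [Z1 Z2]; split.
  rewrite (_ : (fun _ => _) = (fun w => complex.Re (Z w))) //.
  by apply/funext => w; case: (Z w).
rewrite (_ : (fun _ => _) = (fun w => - complex.Im (Z w))).
  exact: measurableT_comp.
by apply/funext => w; case: (Z w).
Qed.

End ComplexMeasurable.

Section ComplexIntegral.
Variables (R : realType) (d : measure_display) (T : measurableType d).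
Variable P : probability T R.
Implicit Types (Z W : T -> R[i]).

Lemma complex_expectationE Z : complex_expectation P Z =
  (\int[P]_w complex.Re (Z w))%R +i* (\int[P]_w complex.Im (Z w))%R.
Proof. by rewrite /complex_expectation unlock. Qed.

Lemma integrable_of_bound (f g : T -> R) : measurable_fun setT f ->
  P.-integrable setT (EFin \o g) -> (forall w, `|f w| <= g w) ->
  P.-integrable setT (EFin \o f).
Proof.
move=> mf ig fg; apply: le_integrable ig => //.
  exact/measurable_EFinP.
move=> w _; rewrite /= lee_fin; apply: le_trans (fg w) _; exact: ler_norm.
Qed.

Lemma normc_ge_Im (x : R[i]) : `|complex.Im x|%:C <= `|x|.
Proof.
case: x => a b; rewrite normc_def lecR /= -sqrtr_sqr.
by apply: ler_wsqrtr; rewrite lerDr sqr_ge0.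
Qed.

Lemma complex_integrable_bound Z (g : T -> R) : cmeas Z ->
  P.-integrable setT (EFin \o g) -> (forall w, `|Z w| <= (g w)%:C) ->
  complex_integrable P Z.
Proof.
move=> [m1 m2] ig Zg; split; apply: integrable_of_bound ig _ => // w.
  by rewrite -lecR; apply: le_trans (Zg w); exact: normc_ge_Re.
by rewrite -lecR; apply: le_trans (Zg w); exact: normc_ge_Im.
Qed.

Lemma eq_complex_integrable Z W : Z =1 W -> complex_integrable P Z -> complex_integrable P W.
Proof. by move=> /funext ->. Qed.

Lemma complex_integrable_cst a : complex_integrable P (fun=> a).
Proof. by split; apply: finite_measure_integrable_cst. Qed.

Lemma complex_expectation_cst a : complex_expectation P (fun=> a) = a.
Proof.
rewrite complex_expectationE !Rintegral_cst //= probability_setT /=.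
by rewrite !mulr1; case: a.
Qed.

Lemma complex_integrableD Z W : complex_integrable P Z -> complex_integrable P W ->
  complex_integrable P (fun w => Z w + W w).
Proof.
move=> [Z1 Z2] [W1 W2]; split.
  by rewrite (_ : _ \o _ = (EFin \o (fun w => complex.Re (Z w))) \+ (EFin \o (fun w => complex.Re (W w))))%E;
    [exact: integrableD | apply/funext => w /=; case: (Z w) (W w) => ? ? []].
by rewrite (_ : _ \o _ = (EFin \o (fun w => complex.Im (Z w))) \+ (EFin \o (fun w => complex.Im (W w))))%E;
  [exact: integrableD | apply/funext => w /=; case: (Z w) (W w) => ? ? []].
Qed.

Lemma complex_expectationD Z W : complex_integrable P Z -> complex_integrable P W ->
  complex_expectation P (fun w => Z w + W w) =
  complex_expectation P Z + complex_expectation P W.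
Proof.
move=> [Z1 Z2] [W1 W2]; rewrite !complex_expectationE; simpc.
rewrite -!RintegralD //; congr (_ +i* _); apply: eq_Rintegral => w _ /=;
  by case: (Z w) (W w) => ? ? [].
Qed.

Lemma complex_integrableZ a Z : complex_integrable P Z ->
  complex_integrable P (fun w => a * Z w).
Proof.
move=> [Z1 Z2]; case: a => x y; split.
  rewrite (_ : _ \o _ = (fun w => x%:E * (complex.Re (Z w))%:E) \+ (fun w => (- y)%:E * (complex.Im (Z w))%:E))%E.
    by apply: integrableD => //; exact: integrableZl.
  by apply/funext => w /=; case: (Z w) => u v /=; rewrite -!EFinM -EFinD mulNr.
rewrite (_ : _ \o _ = (fun w => x%:E * (complex.Im (Z w))%:E) \+ (fun w => y%:E * (complex.Re (Z w))%:E))%E.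
  by apply: integrableD => //; exact: integrableZl.
by apply/funext => w /=; case: (Z w) => u v /=; rewrite -!EFinM -EFinD.
Qed.

Lemma complex_expectationZ a Z : complex_integrable P Z ->
  complex_expectation P (fun w => a * Z w) = a * complex_expectation P Z.
Proof.
move=> [Z1 Z2]; case: a => x y; rewrite !complex_expectationE; simpc.
rewrite -!RintegralZl // -RintegralB // -?RintegralD //; last 4 first.
- exact: (integrableZl _ x Z2).
- exact: (integrableZl _ y Z1).
- exact: (integrableZl _ x Z1).
- exact: (integrableZl _ y Z2).
congr (_ +i* _); apply: eq_Rintegral => w _ /=; by case: (Z w).
Qed.

Lemma complex_integrable_sum I (r : seq I) (F : I -> T -> R[i]) :
  (forall i, complex_integrable P (F i)) ->
  complex_integrable P (fun w => \sum_(i <- r) F i w).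
Proof.
move=> iF; elim: r => [|i r IH].
  by apply: eq_complex_integrable (complex_integrable_cst 0) => w; rewrite big_nil.
by apply: eq_complex_integrable (complex_integrableD (iF i) IH) => w; rewrite big_cons.
Qed.

Lemma complex_expectation_sum I (r : seq I) (F : I -> T -> R[i]) :
  (forall i, complex_integrable P (F i)) ->
  complex_expectation P (fun w => \sum_(i <- r) F i w) =
  \sum_(i <- r) complex_expectation P (F i).
Proof.
move=> iF; elim: r => [|i r IH].
  rewrite big_nil -[RHS]complex_expectation_cst; congr complex_expectation.
  by apply/funext => w; rewrite big_nil.
rewrite big_cons -IH -complex_expectationD //; last exact: complex_integrable_sum.
by congr complex_expectation; apply/funext => w; rewrite big_cons.
Qed.

Lemma complex_expectation_conj Z : complex_integrable P Z ->
  complex_expectation P (fun w => conjc (Z w)) = conjc (complex_expectation P Z).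
Proof.
move=> [Z1 Z2]; rewrite !complex_expectationE /= -mulN1r -RintegralZl //.
by congr (_ +i* _); apply: eq_Rintegral => w _ /=; case: (Z w) => x y //=; rewrite mulN1r.
Qed.

Lemma normc_le_ReIm (z : R[i]) : `|z| <= (`|complex.Re z| + `|complex.Im z|)%:C.
Proof.
case: z => a b; rewrite normc_def lecR /= -[leRHS]ger0_norm ?addr_ge0 //.
rewrite -sqrtr_sqr; apply: ler_wsqrtr; rewrite sqrrD !real_normK ?num_real //.
by rewrite -addrA lerD2l lerDr mulrn_wge0 ?mulr_ge0.
Qed.

Lemma complex_expectation_bound Z (g : T -> R) : cmeas Z ->
  P.-integrable setT (EFin \o g) -> (forall w, `|Z w| <= (g w)%:C) ->
  `|complex_expectation P Z| <= (2 * \int[P]_w g w)%R%:C.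
Proof.
move=> mZ ig Zg; have [Z1 Z2] := complex_integrable_bound mZ ig Zg.
apply: le_trans (normc_le_ReIm _) _; rewrite lecR complex_expectationE /=.
rewrite mulr_natl mulr2n; apply: lerD; apply: le_trans (le_normr_Rintegral _ _) _ => //;
  apply: le_Rintegral => //.
- exact: integrable_norm.
- by move=> w _; rewrite -lecR; apply: le_trans (Zg w); exact: normc_ge_Re.
- exact: integrable_norm.
- by move=> w _; rewrite -lecR; apply: le_trans (Zg w); exact: normc_ge_Im.
Qed.

End ComplexIntegral.

(** * Polynomial-valued functionals of a matrix *)

Section Tame.
Variables (R : realType) (n : nat).
Implicit Types (phi psi : 'M[R[i]]_n -> R[i]) (F G : 'M[R[i]]_n -> {poly R[i]}).

Definition locally_bounded phi := forall B : R, exists K : R,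
  forall C : 'M[R[i]]_n, (forall i j, `|C i j| <= B%:C) -> `|phi C| <= K%:C.

(** Measurability is stated through compositions with random matrices, which
    avoids choosing a sigma-algebra on matrices and makes the stability under
    partial integration a direct instance of Fubini on a product space. *)
Definition borel_functional phi :=
  forall d (T : measurableType d) (Z : T -> 'M[R[i]]_n),
  (forall i j, cmeas (fun w => Z w i j)) -> cmeas (fun w => phi (Z w)).

Definition tame phi := locally_bounded phi /\ borel_functional phi.

Definition tame_poly F := forall k, tame (fun C => (F C)`_k).

Lemma eq_tame phi psi : phi =1 psi -> tame phi -> tame psi.
Proof. by move=> /funext ->. Qed.

Lemma tame_cst a : tame (fun=> a).
Proof.
split=> [B|d T Z _]; last exact: cmeas_cst.
exists (complex.Re `|a|) => C _; rewrite RRe_real //; exact: normr_real.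
Qed.

Lemma tame_entry i j : tame (fun C => C i j).
Proof. by split=> [B|d T Z mZ]; [exists B => C | exact: mZ]. Qed.

Lemma tameD phi psi : tame phi -> tame psi -> tame (fun C => phi C + psi C).
Proof.
move=> [b1 m1] [b2 m2]; split=> [B|d T Z mZ]; last by apply: cmeasD; [exact: m1|exact: m2].
have [K1 H1] := b1 B; have [K2 H2] := b2 B; exists (K1 + K2) => C CB.
by rewrite rmorphD; apply: le_trans (ler_normD _ _) _; apply: lerD; [exact: H1|exact: H2].
Qed.

Lemma tameM phi psi : tame phi -> tame psi -> tame (fun C => phi C * psi C).
Proof.
move=> [b1 m1] [b2 m2]; split=> [B|d T Z mZ]; last by apply: cmeasM; [exact: m1|exact: m2].
have [K1 H1] := b1 B; have [K2 H2] := b2 B; exists (K1 * K2) => C CB.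
by rewrite rmorphM normrM; apply: ler_pM => //; [exact: H1|exact: H2].
Qed.

Lemma tame_sum I (r : seq I) (Q : pred I) (phi : I -> 'M[R[i]]_n -> R[i]) :
  (forall i, Q i -> tame (phi i)) -> tame (fun C => \sum_(i <- r | Q i) phi i C).
Proof.
move=> tphi; elim: r => [|i r IH].
  by apply: eq_tame (tame_cst 0) => C; rewrite big_nil.
case Qi: (Q i); last by apply: eq_tame IH => C; rewrite big_cons Qi.
by apply: eq_tame (tameD (tphi i Qi) IH) => C; rewrite big_cons Qi.
Qed.

Lemma tame_polyM F G : tame_poly F -> tame_poly G -> tame_poly (fun C => F C * G C).
Proof.
move=> tF tG k; apply: (@eq_tame (fun C => \sum_(i < k.+1) (F C)`_i * (G C)`_(k - i))).
  by move=> C; rewrite coefM.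
by apply: tame_sum => i _; exact: tameM.
Qed.

Lemma tame_poly_char_poly : tame_poly (@char_poly _ n : 'M[R[i]]_n -> _).
Proof.
move=> k; rewrite /char_poly /determinant.
apply: (@eq_tame (fun C => \sum_(s : {perm 'I_n})
   ((-1) ^+ s * \prod_i char_poly_mx C i (s i))`_k)).
  by move=> C; rewrite coef_sum.
apply: tame_sum => s _; apply: (@tame_polyM (fun=> (-1) ^+ s)).
  by move=> {}k; exact: tame_cst.
elim: (index_enum _) => [|i r IH] {}k.
  apply: (@eq_tame (fun=> (1 : {poly R[i]})`_k)) => [C|]; last exact: tame_cst.
  by rewrite big_nil.
apply: (@eq_tame (fun C => (char_poly_mx C i (s i) * \prod_(j <- r) char_poly_mx C j (s j))`_k)).
  by move=> C; rewrite big_cons.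
apply: tame_polyM IH k => l.
apply: (@eq_tame (fun C => ('X *+ (i == s i))`_l + (- (l == 0%N)%:R) * C i (s i))).
  move=> C; rewrite !mxE coefB coefC; congr (_ + _).
  by case: (l == 0%N); rewrite ?mul1r ?mulN1r // oppr0 mul0r.
apply: tameD; first exact: tame_cst.
by apply: tameM (tame_entry _ _); exact: tame_cst.
Qed.

End Tame.

Section Admissible.
Local Open Scope sesquilinear_scope.
Variables (R : realType) (n : nat).
Local Notation MC := 'M[R[i]]_n.
Implicit Types (C : MC) (v : 'cV[R[i]]_n) (F : MC -> {poly R[i]}).

Definition outer v : MC := v *m v^t*.

Definition sqnorm v : R := \sum_a ((complex.Re (v a 0)) ^+ 2 + (complex.Im (v a 0)) ^+ 2).

(** The matrix [z - C] has a positive definite imaginary part: [z - C] is a point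
    of the Siegel upper half-space of matrices. *)
Definition siegel (z : R[i]) C :=
  forall u : 'rV[R[i]]_n, u != 0 ->
    0 < complex.Im ((u *m (z%:M - C) *m u^t*) 0 0).

(** The properties of the characteristic polynomial that survive averaging over
    an independent rank-one term.  Stability is required for all complex
    matrices [C], not only for Hermitian ones, because its preservation uses
    complex multiples of a rank-one perturbation; [adm_affine] is what makes
    these multiples computable, and also bounds [F (C + outer v)] by a multiple
    of [1 + |v|^2]. *)
Record admissible F := Admissible {
  adm_monic : forall C, F C \is monic;
  adm_size : forall C, size (F C) = n.+1;
  adm_affine : forall C v t,
    F (C + t *: outer v) = F C + t *: (F (C + outer v) - F C);
  adm_tame : tame_poly F;
  adm_stable : forall z C, siegel z C -> (F C).[z] != 0;
  adm_conj : forall C, F (C^t*) = map_poly conjc (F C) }.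

(** By elimination, [\det (A + s (u w))] is the determinant of the bordered
    matrix with first row [(1, - s w)], which is affine in that row. *)
Lemma det_rank1_affine (K : comPzRingType) (A : 'M[K]_n) (u : 'cV_n) (w : 'rV_n) t :
  \det (A + t *: (u *m w)) = t * \det (A + u *m w) + (1 - t) * \det A.
Proof.
have E s : \det (A + s *: (u *m w)) = \det (block_mx 1%:M (- s *: w) u A).
  have -> : block_mx 1%:M (- s *: w) u A =
     block_mx 1%:M 0 u 1%:M *m block_mx 1%:M (- s *: w) 0 (A + s *: (u *m w)).
    rewrite mulmx_block !mul1mx !mulmx1 !mul0mx !addr0.
    by rewrite -scalemxAr [_ + (A + _)]addrC !scaleNr addrK.
  by rewrite det_mulmx det_lblock det_ublock !det1 !mul1r.
have -> : A + u *m w = A + 1 *: (u *m w) by rewrite scale1r.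
rewrite -{3}[A]addr0 -(scale0r (u *m w)) !E.
apply: (@determinant_multilinear _ _ _ _ _ (lshift n (0 : 'I_1)));
  rewrite /block_mx ?rowKu ?row'Ku ?[row' 0 _]flatmx0 ?flatmx0 //.
rewrite -!linearZ -!linearD /=; congr (row _ _).
rewrite !scale_row_mx add_row_mx; congr (row_mx _ _).
  by rewrite -scalerDl addrC subrK scale1r.
by rewrite oppr0 scale0r scaler0 addr0 scalerA mulrN1.
Qed.

Lemma horner_char_poly C z : (char_poly C).[z] = \det (z%:M - C).
Proof.
rewrite -horner_evalE -det_map_mx; congr (\det _); apply/matrixP => i j.
by rewrite !mxE /= horner_evalE !hornerE hornerMn hornerX.
Qed.

Lemma char_poly_tr C : char_poly C^T = char_poly C.
Proof.
rewrite /char_poly -det_tr; congr (\det _); apply/matrixP => i j.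
by rewrite !mxE eq_sym.
Qed.

Lemma admissible_char_poly : admissible (@char_poly _ n).
Proof.
split.
- exact: char_poly_monic.
- exact: size_char_poly.
- move=> C v t; rewrite /char_poly.
  have E s : char_poly_mx (C + s *: outer v) =
     char_poly_mx C + (- s%:P) *: (map_mx polyC v *m map_mx polyC (v^t*)).
    by rewrite /char_poly_mx raddfD /= opprD addrA map_mxZ -map_mxM scaleNr.
  rewrite -{2}(scale1r (outer v)) !E !(det_rank1_affine _ _ _ (- _)) -!mul_polyC.
  ring.
- exact: tame_poly_char_poly.
- move=> z C Cz; rewrite horner_char_poly; apply/negP => /det0P[u u0 uC].
  by have := Cz u u0; rewrite uC mul0mx mxE ltxx.
- by move=> C; rewrite map_char_poly -[in RHS]char_poly_tr map_trmx.
Qed.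
End Admissible.

(** * Averaging over a random rank-one perturbation *)

Section AlmostEverywhere.
Variables (R : realType) (d : measure_display) (T : measurableType d).
Variable P : probability T R.

(** A random variable of one sign whose mean has the other sign vanishes almost
    surely. *)
Lemma ae_le0_eq0 (f : T -> R) : P.-integrable setT (EFin \o f) ->
  {ae P, forall w, f w <= 0} -> 0 <= (\int[P]_w f w)%R ->
  {ae P, forall w, f w = 0}.
Proof.
move=> fi fle0 If0.
have mf : measurable_fun setT (EFin \o f) by exact: measurable_int fi.
have : (\int[P]_w `|(f w)%:E|)%E = 0%E.
  have iN : P.-integrable setT (EFin \o (fun w => -1 * f w)).
    exact: (integrableZl _ (-1) fi).
  have mN := measurable_int _ iN.
  apply/eqP; rewrite eq_le integral_ge0 ?andbT //.
  rewrite (@ae_eq_integral _ _ _ _ _ (EFin \o (fun w => -1 * f w))) //.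
  - rewrite -(fineK (integrable_fin_num _ iN)) // lee_fin.
    have := @RintegralZl _ _ _ P setT f (-1) measurableT fi.
    by rewrite {1}/Rintegral /= => ->; rewrite mulN1r oppr_le0.
  - exact: measurableT_comp.
  - by apply: filterS fle0 => w w0 _ /=; rewrite mulN1r ler0_norm.
by move/(ae_eq_integral_abs P measurableT mf); apply: filterS => w /= /(_ I) [->].
Qed.

Lemma Rintegral_ae0 (f : T -> R) : measurable_fun setT f ->
  {ae P, forall w, f w = 0} -> (\int[P]_w f w)%R = 0.
Proof.
move=> mf f0; rewrite /Rintegral (@ae_eq_integral _ _ _ _ _ (cst 0%E)) //.
- by rewrite integral0.
- exact/measurable_EFinP.
- by apply: filterS f0 => w -> _.
Qed.

Lemma measurable_Rintegral_param d' (S : measurableType d') (f : S -> T -> R) :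
  measurable_fun setT (fun sw : S * T => f sw.1 sw.2) ->
  measurable_fun setT (fun s => (\int[P]_w f s w)%R).
Proof.
move=> mf; rewrite /Rintegral; apply: measurableT_comp => //.
rewrite (_ : (fun _ => _) = (fun s =>
  \int[P]_w ((fun w => (f s w)%:E)^\+ w) - \int[P]_w ((fun w => (f s w)%:E)^\- w))%E); last first.
  by apply/funext => s; rewrite integralE.
have mf' : measurable_fun setT (fun sw : S * T => (f sw.1 sw.2)%:E).
  exact/measurable_EFinP.
apply: emeasurable_funB.
- rewrite (_ : (fun _ => _) = fubini_F P (fun sw : S * T => (f sw.1 sw.2)%:E)^\+%E); last first.
    by apply/funext => s; apply: eq_integral => w _; rewrite funeposE funeposE.
  have := @measurable_fun_fubini_tonelli_F _ _ S T R P _ (measurable_funepos mf').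
  by apply=> x; exact: funepos_ge0.
- rewrite (_ : (fun _ => _) = fubini_F P (fun sw : S * T => (f sw.1 sw.2)%:E)^\-%E); last first.
    by apply/funext => s; apply: eq_integral => w _; rewrite funenegE funenegE.
  have := @measurable_fun_fubini_tonelli_F _ _ S T R P _ (measurable_funeneg mf').
  by apply=> x; exact: funeneg_ge0.
Qed.

End AlmostEverywhere.

Section RankOne.
Local Open Scope sesquilinear_scope.
Variables (R : realType) (n : nat).
Local Notation MC := 'M[R[i]]_n.
Implicit Types (C : MC) (v : 'cV[R[i]]_n) (F : MC -> {poly R[i]}).

Lemma sqnorm_ge0 v : 0 <= sqnorm v.
Proof. by apply: sumr_ge0 => a _; rewrite addr_ge0 // sqr_ge0. Qed.

Lemma outerE v a b : outer v a b = v a 0 * conjc (v b 0).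
Proof. by rewrite !mxE big_ord1 !mxE. Qed.

Lemma outer_scale (x : R) v : outer (x%:C *: v) = (x ^+ 2)%:C *: outer v.
Proof.
apply/matrixP => a b; rewrite [RHS]mxE !outerE !mxE.
have -> : conjc (x%:C * v b 0) = x%:C * conjc (v b 0).
  by rewrite rmorphM; congr (_ * _); exact: conjc_real.
by rewrite rmorphXn expr2 mulrACA.
Qed.

Lemma outer_herm v : (outer v)^t* = outer v.
Proof.
apply/matrixP => a b; rewrite 2!mxE !outerE rmorphM /= conjCK mulrC //.
Qed.

Lemma normc_entry v a (s : R) : sqnorm v <= s -> `|v a 0| <= (Num.sqrt s)%:C.
Proof.
move=> vs; rewrite normc_def lecR ler_wsqrtr //; apply: le_trans vs.
rewrite /sqnorm (bigD1 a) //= lerDl sumr_ge0 // => b _.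
by rewrite addr_ge0 // sqr_ge0.
Qed.

(** Writing [v = sqrt (1 + |v|^2) u], the entries of [u] are at most one, and
    [F] is affine along [outer u] with slope controlled by its values on a
    bounded set of matrices. *)
Lemma admissible_growth F k (B : R) : admissible F -> exists K : R,
  forall C, (forall a b, `|C a b| <= B%:C) ->
  forall v, `|(F (C + outer v))`_k| <= (K * (1 + sqnorm v))%:C.
Proof.
move=> aF; have [bF _] := adm_tame aF k; have [K HK] := bF (B + 1).
(* [K] bounds both [F C] and [F (C + outer u)]. *)
exists (3 * K) => C CB v; have N0 := sqnorm_ge0 v.
have N1 : 0 < 1 + sqnorm v by rewrite ltr_pwDl.
set s := Num.sqrt (1 + sqnorm v); have s0 : 0 < s by rewrite sqrtr_gt0.
pose u := (s^-1)%:C *: v.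
have -> : outer v = ((1 + sqnorm v)%:C) *: outer u.
  rewrite outer_scale scalerA -rmorphM /= exprVn sqr_sqrtr ?(ltW N1) //.
  by rewrite divff ?gt_eqF // scale1r.
have u1 a : `|u a 0| <= 1.
  rewrite mxE normrM -(ler_pM2l (x := s%:C)) ?ltcR // mulr1 mulrA.
  rewrite [`|(s^-1)%:C|]ger0_norm ?lecR ?invr_ge0 ?(ltW s0) //.
  rewrite -rmorphM divff ?gt_eqF // rmorph1 mul1r.
  by apply: normc_entry; rewrite lerDr.
have CB1 a b : `|C a b| <= (B + 1)%:C.
  by apply: le_trans (CB a b) _; rewrite lecR lerDl.
have CuB a b : `|(C + outer u) a b| <= (B + 1)%:C.
  rewrite mxE outerE rmorphD; apply: le_trans (ler_normD _ _) _.
  apply: lerD => //; rewrite normrM normcJ.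
  by rewrite -[leRHS]mulr1; apply: ler_pM.
rewrite adm_affine // coefD coefZ coefB.
apply: le_trans (ler_normD _ _) _; rewrite normrM.
have F1 := HK _ CB1; have F2 := HK _ CuB.
have K0 : 0 <= K by rewrite -lecR; apply: le_trans F1; exact: normr_ge0.
have -> : 3 * K * (1 + sqnorm v) = K * (1 + sqnorm v) + (1 + sqnorm v) * (K + K) by ring.
rewrite [leRHS]rmorphD; apply: lerD.
  by apply: le_trans F1 _; rewrite lecR ler_peMr // lerDl.
rewrite rmorphM; apply: ler_pM => //.
  by rewrite ger0_norm // lecR ltW.
by rewrite rmorphD; apply: le_trans (ler_normB _ _) _; apply: lerD.
Qed.

Lemma siegel_sub z C v t : siegel z C -> complex.Im t <= 0 ->
  siegel z (C + t *: outer v).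
Proof.
move=> zC t0 u u0; have := zC u u0.
have -> : u *m (z%:M - (C + t *: outer v)) *m u^t* =
   u *m (z%:M - C) *m u^t* - t *: ((u *m v) *m (u *m v)^t*).
  rewrite opprD addrA mulmxBr mulmxBl; congr (_ - _).
  by rewrite -scalemxAr -scalemxAl /outer trmx_mul map_mxM !mulmxA.
have E (A B : 'M[R[i]]_1) :
    (A - t *: (B *m B^t*)) 0 0 = A 0 0 - t * (B 0 0 * conjc (B 0 0)).
  by rewrite !mxE big_ord1 !mxE.
rewrite E; case: (_ 0 0) ((u *m v) 0 0) => [x1 x2] [y1 y2].
case: t t0 {E} => t1 t2 /= t0.
have := sqr_ge0 y1; have := sqr_ge0 y2; nra.
Qed.

(** By affinity, [F (C + t (outer v))] equals [F C] times [1 - t * rho] at [z],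
    and stability forbids its vanishing when
    [Im t <= 0].  So, if [rho] is nonzero, [1 / rho] has positive imaginary
    part. *)
Lemma admissible_ratio F z C v : admissible F -> siegel z C ->
  let rho := ((F C).[z] - (F (C + outer v)).[z]) / (F C).[z] in
  complex.Im rho <= 0 /\ (complex.Im rho = 0 -> rho = 0).
Proof.
move=> aF zC rho; have D0 := adm_stable aF zC.
suff H : rho != 0 -> complex.Im rho < 0.
  case: (eqVneq rho 0) => [->|/H rho0]; first by [].
  by split; [exact: ltW | move=> e; rewrite e ltxx in rho0].
move=> rho0; rewrite ltNge; apply/negP => Im0.
have t0 : complex.Im rho^-1 <= 0.
  case: (rho) Im0 => x y /= y0; simpc.
  by rewrite oppr_le0 divr_ge0 // addr_ge0 ?sqr_ge0.
have /negP := adm_stable aF (siegel_sub v zC t0); apply.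
rewrite adm_affine // hornerD hornerZ hornerD hornerN -[_ - (F C).[z]]opprB mulrN.
by rewrite /rho invf_div divfK ?subrr //; apply: contraNneq rho0 => e; rewrite /rho e mul0r.
Qed.

End RankOne.

Section AverageAdmissible.
Local Open Scope sesquilinear_scope.
Variables (R : realType) (n : nat) (d : measure_display) (T : measurableType d).
Variables (P : probability T R) (X : T -> 'cV[R[i]]_n).
Hypothesis mX : forall a, cmeas (fun w => X w a 0).
Hypothesis iX : P.-integrable setT (EFin \o (fun w => sqnorm (X w))).
Local Notation MC := 'M[R[i]]_n.
Implicit Types (C : MC) (F : MC -> {poly R[i]}).

(** Conditional expectation of [F] given that the other terms sum to [C]. *)
Definition average F C := poly_expectation P n (fun w => F (C + outer (X w))).

Lemma cmeas_add_outer d' (S : measurableType d') (Z : S -> MC) (Y : S -> 'cV[R[i]]_n) :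
  (forall a b, cmeas (fun s => Z s a b)) -> (forall a, cmeas (fun s => Y s a 0)) ->
  forall a b, cmeas (fun s => (Z s + outer (Y s)) a b).
Proof.
move=> mZ mY a b.
apply: (@eq_cmeas _ _ _ (fun s => Z s a b + Y s a 0 * conjc (Y s b 0))).
  by move=> s; rewrite mxE outerE.
by apply: cmeasD => //; apply: cmeasM => //; exact: cmeas_conj.
Qed.

Lemma integrable_growth (K : R) :
  P.-integrable setT (EFin \o (fun w => K * (1 + sqnorm (X w)))).
Proof.
have := integrableD measurableT (finite_measure_integrable_cst P 1 measurableT) iX.
by move/(integrableZl measurableT K).
Qed.

Lemma mx_bounded C : exists B : R, forall a b, `|C a b| <= B%:C.
Proof.
exists (\sum_a \sum_b complex.Re `|C a b|) => a b.
have H x y : `|C x y| = (complex.Re `|C x y|)%:C by rewrite (RRe_real (normr_real (C x y))).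
have H0 x y : 0 <= complex.Re `|C x y| by rewrite -lecR -H; exact: normr_ge0.
rewrite H lecR (bigD1 a) //= (bigD1 b) //= -addrA lerDl.
by rewrite addr_ge0 //; do ?[apply: sumr_ge0 => ? _ //]; exact: H0.
Qed.

Lemma admissible_integrable F C : admissible F ->
  poly_integrable P (fun w => F (C + outer (X w))).
Proof.
move=> aF k; have [B CB] := mx_bounded C.
have [K HK] := admissible_growth k B aF.
apply: (complex_integrable_bound _ (integrable_growth K)).
  apply: (adm_tame aF k).2; apply: cmeas_add_outer => // a b; exact: cmeas_cst.
by move=> w; exact: HK.
Qed.

Lemma coef_average F C k : admissible F ->
  (average F C)`_k = complex_expectation P (fun w => (F (C + outer (X w)))`_k).
Proof.
move=> aF; rewrite coef_poly; case: ltnP => // nk.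
rewrite -[LHS](@complex_expectation_cst _ _ _ P); congr complex_expectation.
by apply/funext => w; rewrite nth_default // (adm_size aF).
Qed.

Lemma horner_average F C z : admissible F ->
  complex_integrable P (fun w => (F (C + outer (X w))).[z]) /\
  (average F C).[z] = complex_expectation P (fun w => (F (C + outer (X w))).[z]).
Proof.
move=> aF.
have -> : (fun w => (F (C + outer (X w))).[z]) =
          (fun w => \sum_(k < n.+1) z ^+ k * (F (C + outer (X w)))`_k).
  apply/funext => w; rewrite horner_coef (adm_size aF).
  by apply: eq_bigr => k _; rewrite mulrC.
have iF := admissible_integrable C aF; split.
  by apply: complex_integrable_sum => k; apply: complex_integrableZ.
rewrite complex_expectation_sum => [|k]; last exact: complex_integrableZ.
rewrite (horner_coef_wide _ (size_poly _ _)); apply: eq_bigr => k _.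
by rewrite complex_expectationZ // coef_average // mulrC.
Qed.

Lemma average_lead F C : admissible F ->
  size (average F C) = n.+1 /\ average F C \is monic.
Proof.
move=> aF.
have lc : (average F C)`_n = 1.
  rewrite coef_average // -[RHS](@complex_expectation_cst _ _ _ P).
  congr complex_expectation; apply/funext => w.
  by have /monicP := adm_monic aF (C + outer (X w)); rewrite lead_coefE (adm_size aF).
have sz : size (average F C) = n.+1.
  apply/eqP; rewrite eqn_leq size_poly /= ltnNge; apply/negP => szn.
  by move: lc; rewrite nth_default // => /eqP; rewrite eq_sym oner_eq0.
by split=> //; rewrite monicE lead_coefE sz lc.
Qed.

Lemma average_ratio F z C : admissible F -> siegel z C ->
  let Z w := ((F C).[z] - (F (C + outer (X w))).[z]) / (F C).[z] in
  complex_integrable P Z /\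
  complex_expectation P Z = ((F C).[z] - (average F C).[z]) / (F C).[z].
Proof.
move=> aF zC Z; have [iF EF] := horner_average C z aF.
have iD := complex_integrable_cst P ((F C).[z]).
have iN := complex_integrableZ (-1) iF.
have ZE : Z = (fun w => ((F C).[z])^-1 * ((F C).[z] + -1 * (F (C + outer (X w))).[z])).
  by apply/funext => w; rewrite /Z mulN1r mulrC.
have iDN := complex_integrableD iD iN.
rewrite ZE; split; first exact: complex_integrableZ.
rewrite complex_expectationZ // complex_expectationD // complex_expectation_cst.
by rewrite complex_expectationZ // -EF mulN1r mulrC.
Qed.

(** The ratios of [admissible_ratio] lie in a closed convex half-plane, which
    contains their mean. *)
Lemma average_ratio_Im F z C : admissible F -> siegel z C ->
  complex.Im (((F C).[z] - (average F C).[z]) / (F C).[z]) <= 0.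
Proof.
move=> aF zC; have [[_ iI] <-] := average_ratio aF zC.
rewrite complex_expectationE /= -oppr_ge0 -mulN1r -RintegralZl //.
apply: Rintegral_ge0 => // w _; rewrite mulN1r oppr_ge0.
exact: (admissible_ratio (X w) aF zC).1.
Qed.

(** Stability is the essential point.  If the average vanished at [z], the
    ratios of [admissible_ratio] would have mean [1]; then their nonpositive
    imaginary parts have mean [0], hence vanish almost surely, and with them the
    ratios themselves, which contradicts the mean being [1].  The other
    properties are inherited by linearity and domination. *)
Lemma admissible_average F : admissible F -> admissible (average F).
Proof.
move=> aF; split.
- by move=> C; have [] := average_lead C aF.
- by move=> C; have [] := average_lead C aF.
- move=> C v t; apply/polyP => k; rewrite coefD coefZ coefB !coef_average //.
  have i1 := admissible_integrable C aF k.
  have i2 := admissible_integrable (C + outer v) aF k.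
  have i3 := complex_integrableZ (-1) i1.
  rewrite -mulN1r -!complex_expectationZ // -complex_expectationD //.
  rewrite -!complex_expectationZ; last exact: complex_integrableD.
  rewrite -complex_expectationD //; last first.
    by apply: complex_integrableZ; exact: complex_integrableD.
  congr complex_expectation; apply/funext => w.
  rewrite -!(addrAC _ (outer (X w))) (adm_affine aF) coefD coefZ coefB mulN1r.
  by [].
- move=> k; split.
    move=> B; have [K HK] := admissible_growth k B aF.
    exists (2 * \int[P]_w (K * (1 + sqnorm (X w))))%R => C CB.
    rewrite coef_average //; apply: complex_expectation_bound (integrable_growth K) _.
      apply: (adm_tame aF k).2; apply: cmeas_add_outer => // a b; exact: cmeas_cst.
    by move=> w; exact: HK.
  move=> d' S Z mZ.
  have mj : cmeas (fun sw : S * T => (F (Z sw.1 + outer (X sw.2)))`_k).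
    apply: (adm_tame aF k).2; apply: cmeas_add_outer => [a b|a].
      by split; [apply: (measurableT_comp (mZ a b).1) | apply: (measurableT_comp (mZ a b).2)].
    by split; [apply: (measurableT_comp (mX a).1) | apply: (measurableT_comp (mX a).2)].
  have -> : (fun s => (average F (Z s))`_k) =
      (fun s => complex_expectation P (fun w => (F (Z s + outer (X w)))`_k)).
    by apply/funext => s; rewrite coef_average.
  split.
    under eq_fun do rewrite complex_expectationE /=.
    exact: (@measurable_Rintegral_param _ _ _ P _ _ (fun s w => complex.Re (F (Z s + outer (X w)))`_k) mj.1).
  under eq_fun do rewrite complex_expectationE /=.
  exact: (@measurable_Rintegral_param _ _ _ P _ _ (fun s w => complex.Im (F (Z s + outer (X w)))`_k) mj.2).
- move=> z C zC; apply/negP => /eqP A0.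
  have D0 := adm_stable aF zC.
  have [[iR iI]] := average_ratio aF zC.
  rewrite A0 subr0 divff // complex_expectationE => -[R1 I0].
  have : {ae P, forall w, complex.Im (((F C).[z] - (F (C + outer (X w))).[z]) / (F C).[z]) = 0}.
    apply: ae_le0_eq0 => //; last by rewrite I0.
    by apply: aeW => w; exact: (admissible_ratio (X w) aF zC).1.
  move=> ae0.
  have : (\int[P]_w complex.Re (((F C).[z] - (F (C + outer (X w))).[z]) / (F C).[z]))%R = 0.
    apply: Rintegral_ae0.
      by have /measurable_EFinP := measurable_int _ iR.
    apply: filterS ae0 => w w0.
    by have [_ ->] := admissible_ratio (X w) aF zC.
  by rewrite R1 => /eqP; rewrite oner_eq0.
- move=> C; apply/polyP => k; rewrite coef_map /= !coef_average //.
  rewrite -complex_expectation_conj; last exact: admissible_integrable.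
  congr complex_expectation; apply/funext => w.
  have -> : C^t* + outer (X w) = (C + outer (X w))^t*.
    by rewrite -{1}outer_herm linearD /= map_mxD.
  by rewrite (adm_conj aF) coef_map.
Qed.

End AverageAdmissible.

(** * Root counts of an average *)

Section SignedGerm.
Variable R : realType.
Implicit Types (p q : {poly R[i]}) (b : bool) (c : R).

(** For real-rooted [p] this condition on the coefficients tests the parity of
    the number of roots counted by [above b c], see [sgermP]. *)
Definition sgerm b c k p := pos_germ ((-1) ^+ k *: recenter b c (Re_poly p)).

Lemma sgermP b c k p : p \is monic -> real_rooted p ->
  sgerm b c k p <-> odd k = odd (nroots b c p).
Proof.
move=> mp rp; have pg := pos_germ_nroots b c mp rp.
rewrite -signr_odd in pg; rewrite /sgerm -signr_odd.
split=> [pk|->//]; apply/eqP; apply: contraT.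
case: (odd k) pk; case: (odd _) pg => //=;
  rewrite !(expr0, expr1) !(scale1r, scaleN1r) => pg pk _.
- by have := pos_germ_opp pg.
- by have := pos_germ_opp pk.
Qed.

Lemma coef_recenter b c (p : {poly R}) m i : (size p <= m)%N ->
  (recenter b c p)`_i = \sum_(k < m) p`_k * ((c%:P + (-1) ^+ b *: 'X) ^+ k)`_i.
Proof.
move=> pm; rewrite /recenter coef_comp_poly.
rewrite (big_ord_widen m (fun k => p`_k * ((c%:P + (-1) ^+ b *: 'X) ^+ k)`_i) pm).
rewrite big_mkcond; apply: eq_bigr => k _; case: ltnP => // pk.
by rewrite nth_default // mul0r.
Qed.

Definition recenter_weight b c k i j : R :=
  (-1) ^+ k * ((c%:P + (-1) ^+ b *: 'X : {poly R}) ^+ j)`_i.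

Lemma coef_signed_recenter b c k i p m : (size p <= m)%N ->
  ((-1) ^+ k *: recenter b c (Re_poly p))`_i =
  \sum_(j < m) recenter_weight b c k i j * complex.Re p`_j.
Proof.
move=> pm; rewrite coefZ (@coef_recenter _ _ _ m); last first.
  exact: leq_trans (size_poly _ _) pm.
rewrite mulr_sumr; apply: eq_bigr => j _.
by rewrite coef_map_id0 // /recenter_weight mulrCA mulrC.
Qed.

End SignedGerm.

Section RandomGerm.
Variables (R : realType) (d : measure_display) (T : measurableType d).

Lemma measurable_pos_germ (p : T -> {poly R}) :
  (forall k, measurable_fun setT (fun w => (p w)`_k)) ->
  measurable [set w | pos_germ (p w)].
Proof.
move=> mp.
have -> : [set w | pos_germ (p w)] = \bigcup_i
    ((\bigcap_j (if (j < i)%N then (fun w => (p w)`_j) @^-1` [set 0] else setT)) `&`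
     ((fun w => (p w)`_i) @^-1` `]0, +oo[)).
  apply/seteqP; split => w.
    move=> [i [p0 pi]]; exists i => //; split => /=; last by rewrite in_itv /= pi.
    by move=> j _; case: ifP => // ji; exact: p0.
  move=> [i _ [/= p0]]; rewrite in_itv /= andbT => pi; exists i; split => // j ji.
  by have := p0 j I; rewrite ji.
apply: bigcupT_measurable => i; apply: measurableI.
  apply: bigcapT_measurable => j; case: ifP => // _.
  by rewrite -[X in measurable X]setTI; apply: mp.
by rewrite -[X in measurable X]setTI; apply: mp.
Qed.

Lemma measurable_signed_recenter b c k i (p : T -> {poly R[i]}) m :
  (forall w, (size (p w) <= m)%N) -> (forall j, cmeas (fun w => (p w)`_j)) ->
  measurable_fun setT
    (fun w => ((-1) ^+ k *: recenter b c (Re_poly (p w)))`_i).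
Proof.
move=> pm mp.
under eq_fun do rewrite (coef_signed_recenter _ _ _ _ (pm _)).
apply: measurable_sum => j; apply: measurable_funM; first exact: measurable_cst.
exact: (mp j).1.
Qed.

Variable P : probability T R.

Lemma Rintegral_lincomb I (r : seq I) (a : I -> R) (f : I -> T -> R) :
  (forall j, P.-integrable setT (EFin \o f j)) ->
  P.-integrable setT (EFin \o (fun w => \sum_(j <- r) a j * f j w)) /\
  (\int[P]_w (\sum_(j <- r) a j * f j w) = \sum_(j <- r) a j * \int[P]_w f j w)%R.
Proof.
move=> fi; elim: r => [|j r [IHi IH]].
  have -> : (fun w => \sum_(j <- [::]) a j * f j w) = cst 0.
    by apply/funext => w; rewrite big_nil.
  by rewrite big_nil Rintegral_cst // mul0r; split=> //; exact: finite_measure_integrable_cst.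
have ij : P.-integrable setT (EFin \o (fun w => a j * f j w)).
  exact: (integrableZl measurableT (a j) (fi j)).
have -> : (fun w => \sum_(l <- j :: r) a l * f l w) =
    (fun w => a j * f j w + \sum_(l <- r) a l * f l w).
  by apply/funext => w; rewrite big_cons.
split; first exact: (integrableD measurableT ij IHi).
by rewrite RintegralD // RintegralZl // IH big_cons.
Qed.

Lemma ae_not (A : set T) : measurable A -> P A = 0%E -> {ae P, forall w, ~ A w}.
Proof. by move=> mA PA; exists A; split => // w /= /contrapT. Qed.

(** If no value of [p] had a positive germ almost surely, then inductively each
    coefficient below the leading one of the germ of the mean would be
    nonpositive with mean zero, hence zero almost surely; the coefficient that
    makes the germ of the mean positive would then be nonpositive as well. *)
Lemma pos_germ_expectation (p : T -> {poly R}) (q : {poly R}) :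
  (forall k, P.-integrable setT (EFin \o (fun w => (p w)`_k))) ->
  (forall k, q`_k = (\int[P]_w (p w)`_k)%R) ->
  pos_germ q -> ~ {ae P, forall w, ~ pos_germ (p w)}.
Proof.
move=> ip qp [i [q0 qi]] npos.
have le0 k : {ae P, forall w, forall j, (j < k)%N -> (p w)`_j = 0} ->
    {ae P, forall w, (p w)`_k <= 0}.
  move=> p0; apply: filterS2 npos p0 => w np p0.
  by rewrite leNgt; apply/negP => pk; apply: np; exists k.
have eq0 k : (k <= i)%N -> {ae P, forall w, forall j, (j < k)%N -> (p w)`_j = 0}.
  elim: k => [|k IH] ki; first exact: aeW.
  have {}IH := IH (ltnW ki).
  have : {ae P, forall w, (p w)`_k = 0}.
    by apply: ae_le0_eq0 => //; [exact: le0 | rewrite -qp q0].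
  apply: filterS2 IH => w pj pk j; rewrite ltnS leq_eqVlt => /predU1P[->//|].
  exact: pj.
have : {ae P, forall w, (p w)`_i = 0}.
  by apply: ae_le0_eq0 => //; [apply: le0; exact: eq0 | rewrite -qp ltW].
move=> /Rintegral_ae0; rewrite -qp => e.
have /e qi0 : measurable_fun setT (fun w => (p w)`_i).
  by have /measurable_EFinP := measurable_int _ (ip i).
by rewrite qi0 ltxx in qi.
Qed.

End RandomGerm.

Section HermitianRoots.
Local Open Scope sesquilinear_scope.
Variables (R : realType) (n : nat).
Local Notation MC := 'M[R[i]]_n.
Implicit Types (C : MC) (v : 'cV[R[i]]_n) (F : MC -> {poly R[i]}) (b : bool) (c : R).

(** For Hermitian [C] the form [u C u^*] is real, and only [z |u|^2] contributes
    to the imaginary part. *)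
Lemma herm_siegel z C : C^t* = C -> 0 < complex.Im z -> siegel z C.
Proof.
move=> hC z0 u u0.
have -> : u *m (z%:M - C) *m u^t* = z *: (u *m u^t*) - u *m C *m u^t*.
  by rewrite mulmxBr mulmxBl mul_mx_scalar -scalemxAl.
have uu : 0 < complex.Re ((u *m u^t*) 0 0) /\ complex.Im ((u *m u^t*) 0 0) = 0.
  have -> : (u *m u^t*) 0 0 = (\sum_a ((complex.Re (u 0 a)) ^+ 2 + (complex.Im (u 0 a)) ^+ 2))%:C.
    rewrite mxE rmorph_sum; apply: eq_bigr => a _; rewrite !mxE.
    by rewrite -[RHS]/(_%:C) add_Re2_Im2 sqr_normc.
  split=> //=; rewrite lt_def sumr_ge0 ?andbT => [|a _]; last by rewrite addr_ge0 ?sqr_ge0.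
  apply: contraNneq u0 => s0; apply/eqP/rowP => a; rewrite mxE.
  have : complex.Re (u 0 a) ^+ 2 + complex.Im (u 0 a) ^+ 2 == 0.
    move/eqP: s0; rewrite psumr_eq0 => [|e _]; last by rewrite addr_ge0 ?sqr_ge0.
    by move/allP => /(_ a); rewrite mem_index_enum => /(_ isT).
  rewrite paddr_eq0 ?sqr_ge0 // !sqrf_eq0; case: (u 0 a) => x y /= /andP[/eqP -> /eqP ->].
  by [].
have uCu : complex.Im ((u *m C *m u^t*) 0 0) = 0.
  have : (u *m C *m u^t*)^t* = u *m C *m u^t*.
    by rewrite !trmx_mul !map_mxM trmxCK hC mulmxA.
  by move/matrixP => /(_ 0 0); rewrite mxE mxE; case: (_ 0 0) => x y [] /= yy; lra.
have E (A B : 'M[R[i]]_1) : (z *: A - B) 0 0 = z * A 0 0 - B 0 0.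
  by rewrite !mxE.
rewrite {}E.
case: uu uCu; case: (_ 0 0) => x1 x2; case: (_ 0 0) => y1 y2 /= x0 -> ->.
by case: z z0 => z1 z2 /= z0; rewrite mulr0 add0r oppr0 addr0 mulr_gt0.
Qed.

Lemma admissible_real_rooted F C : admissible F -> C^t* = C -> real_rooted (F C).
Proof.
move=> aF hC; apply: real_rooted_upper.
  by rewrite -[in RHS]hC (adm_conj aF).
by move=> z z0; apply: (adm_stable aF); exact: herm_siegel.
Qed.

Lemma Im_mulJ_ge0 (f g : R[i]) : f != 0 -> complex.Im ((f - g) / f) <= 0 ->
  0 <= complex.Im (g * conjc f).
Proof.
move=> f0; rewrite mulrBl divff //.
have -> : g * conjc f = (g / f) * (f * conjc f) by rewrite mulrA divfK.
move: f (g / f) {f0} => [p q] [x y] /=; rewrite sub0r oppr_le0 => y0.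
have -> : p * - q + q * p = 0 by ring.
rewrite mulr0 add0r mulr_ge0 //.
have := sqr_ge0 p; have := sqr_ge0 q; nra.
Qed.

Lemma herm_add_outer C v : C^t* = C -> (C + outer v)^t* = C + outer v.
Proof. by move=> hC; rewrite linearD /= map_mxD hC outer_herm. Qed.

Lemma nroots_add_outer F C v b c : admissible F -> C^t* = C ->
  (nroots b c (F C) <= nroots b c (F (C + outer v)%R) <= (nroots b c (F C)).+1)%N.
Proof.
move=> aF hC; have hCv := herm_add_outer v hC.
apply: nroots_interlacing; try exact: (adm_monic aF); try exact: admissible_real_rooted.
move=> z z0; have zC := herm_siegel hC z0.
by apply: Im_mulJ_ge0 (adm_stable aF zC) _; exact: (admissible_ratio v aF zC).1.
Qed.

Section Average.
Variables (d : measure_display) (T : measurableType d).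
Variables (P : probability T R) (X : T -> 'cV[R[i]]_n).
Hypothesis mX : forall a, cmeas (fun w => X w a 0).
Hypothesis iX : P.-integrable setT (EFin \o (fun w => sqnorm (X w))).

Lemma nroots_average F C b c : admissible F -> C^t* = C ->
  (nroots b c (F C) <= nroots b c (average P X F C) <= (nroots b c (F C)).+1)%N.
Proof.
move=> aF hC; have aA := admissible_average mX iX aF.
apply: nroots_interlacing; try exact: (adm_monic aF); try exact: (adm_monic aA);
  try exact: admissible_real_rooted.
move=> z z0; have zC := herm_siegel hC z0.
by apply: Im_mulJ_ge0 (adm_stable aF zC) _; exact: average_ratio_Im.
Qed.

Lemma nroots_average_eq F C v b c : admissible F -> C^t* = C ->
  nroots b c (F (C + outer v)) = nroots b c (average P X F C) <->
  sgerm b c (nroots b c (average P X F C)) (F (C + outer v)).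
Proof.
move=> aF hC; have hCv := herm_add_outer v hC.
rewrite (sgermP b c _ (adm_monic aF _) (admissible_real_rooted aF hCv)).
have := nroots_average b c aF hC; have := nroots_add_outer v b c aF hC.
set x := nroots _ _ _; set y := nroots _ _ _; set z := nroots _ _ _.
by split=> [->//|]; lia.
Qed.

Lemma integrable_recenter F C b c k i : admissible F ->
  P.-integrable setT (EFin \o (fun w =>
    ((-1) ^+ k *: recenter b c (Re_poly (F (C + outer (X w)))))`_i)) /\
  ((-1) ^+ k *: recenter b c (Re_poly (average P X F C)))`_i =
  (\int[P]_w ((-1) ^+ k *: recenter b c (Re_poly (F (C + outer (X w)))))`_i)%R.
Proof.
move=> aF.
have [] := @Rintegral_lincomb _ _ _ P _ (index_enum 'I_n.+1)
  (recenter_weight b c k i) (fun j w => complex.Re (F (C + outer (X w)))`_j).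
  by move=> j; exact: (admissible_integrable mX iX C aF j).1.
move=> h1 h2; rewrite (coef_signed_recenter _ _ _ _ (size_poly _ _)).
have -> : (fun w => ((-1) ^+ k *: recenter b c (Re_poly (F (C + outer (X w)))))`_i) =
    (fun w => \sum_(j < n.+1) recenter_weight b c k i j *
       complex.Re (F (C + outer (X w)))`_j).
  by apply/funext => w; apply: coef_signed_recenter; rewrite (adm_size aF).
split=> //; rewrite h2; apply: eq_bigr => j _; congr (_ * _).
by rewrite coef_average // complex_expectationE.
Qed.

(** Both [F (C + outer (X w))] and the average have either as many counted roots
    as [F C] or one more.  So they agree as soon as the parities agree, and
    parity is the sign of a germ, which the average cannot have unless it is
    taken with positive probability. *)
Lemma prob_nroots_average F C b c : admissible F -> C^t* = C ->
  (0 < P [set w | nroots b c (F (C + outer (X w))%R) = nroots b c (average P X F C)])%E.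
Proof.
move=> aF hC; set k := nroots b c (average _ _ _ _).
have aA := admissible_average mX iX aF.
have -> : [set w | nroots b c (F (C + outer (X w))) = k] =
          [set w | sgerm b c k (F (C + outer (X w)))].
  by apply/seteqP; split => w /=; rewrite nroots_average_eq.
have iF i := integrable_recenter C b c k i aF.
have mS : measurable [set w | sgerm b c k (F (C + outer (X w)))].
  apply: measurable_pos_germ => i.
  by have /measurable_EFinP := measurable_int _ (iF i).1.
rewrite lt_def measure_ge0 andbT; apply/eqP => P0.
apply: (pos_germ_expectation (fun i => (iF i).1) (fun i => (iF i).2)).
  apply/(sgermP b c k (adm_monic aA C) (admissible_real_rooted aA hC)); by [].
exact: (ae_not mS P0).
Qed.

End Average.

(** A rank-one term increases the root count by at most one, so the new count is
    known from the old one and from a parity, which is measurable. *)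
Lemma measurable_nroots_add_outer d (S : measurableType d) F (Z : S -> MC)
    (Y : S -> 'cV[R[i]]_n) b c : admissible F ->
  (forall s, (Z s)^t* = Z s) -> (forall x y, cmeas (fun s => Z s x y)) ->
  (forall x, cmeas (fun s => Y s x 0)) ->
  (forall k, measurable [set s | nroots b c (F (Z s)) = k]) ->
  forall k, measurable [set s | nroots b c (F (Z s + outer (Y s))) = k].
Proof.
move=> aF hZ mZ mY mN k.
(* For [k = 0] the two sets of the union coincide, as [0.-1 = 0]. *)
have -> : [set s | nroots b c (F (Z s + outer (Y s))) = k] =
  ([set s | nroots b c (F (Z s)) = k] `|` [set s | nroots b c (F (Z s)) = k.-1])
  `&` [set s | sgerm b c k (F (Z s + outer (Y s)))].
  apply/seteqP; split => s /=; have := nroots_add_outer (Y s) b c aF (hZ s);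
    rewrite (sgermP b c k (adm_monic aF _)
      (admissible_real_rooted aF (herm_add_outer (Y s) (hZ s))));
    set x := nroots _ _ _; set y := nroots _ _ _.
    by move=> xy <-; split => //; lia.
  by move=> xy [xk odd]; lia.
apply: measurableI; first exact: measurableU.
apply: measurable_pos_germ => i; apply: (@measurable_signed_recenter _ _ _ _ _ _ _ _ n.+1) => [s|j].
  by rewrite (adm_size aF).
by apply: (adm_tame aF j).2; exact: cmeas_add_outer.
Qed.

End HermitianRoots.

(** * Fubini for an independent pair *)

Section IndependentPair.
Variables (R : realType) (d d1 d2 : measure_display).
Variables (T : measurableType d) (S : measurableType d1) (V : measurableType d2).
Variables (P : probability T R) (f : {mfun T >-> S}) (g : {mfun T >-> V}).
Hypothesis fg_indep : forall A B, measurable A -> measurable B ->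
  P (f @^-1` A `&` g @^-1` B) = (P (f @^-1` A) * P (g @^-1` B))%E.

Let pair w := (f w, g w).

Let mpair : measurable_fun setT pair.
Proof. exact/measurable_fun_pair. Qed.

Let pair_mixin := isMeasurableFun.Build _ _ _ _ _ mpair.
Let pair_mfun : {mfun T >-> (S * V)%type} := HB.pack pair pair_mixin.

Let pair_law (E : set (S * V)) : measurable E ->
  (distribution P f \x distribution P g)%E E = distribution P pair_mfun E.
Proof. by apply: product_measure_unique => A B mA mB; rewrite -fg_indep. Qed.

(** The joint law of [f] and [g] is the product of their laws. *)
Lemma prob_pair (E : set (S * V)) : measurable E ->
  P [set w | E (f w, g w)] = (\int[P]_w P [set w' | E (f w, g w')])%E.
Proof.
move=> mE; have -> : P [set w | E (f w, g w)] = distribution P pair_mfun E by [].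
rewrite -pair_law // /product_measure1 ge0_integral_distribution //; last exact: measurable_fun_xsection.
apply: eq_integral => w _ /=; rewrite /distribution /pushforward.
by congr (P _); apply/seteqP; split => w' /=; rewrite /xsection /= inE.
Qed.

Lemma prob_pair_gt0 (E : set (S * V)) (A : set T) : measurable E ->
  measurable A -> (0 < P A)%E -> (forall w, A w -> (0 < P [set w' | E (f w, g w')])%E) ->
  (0 < P [set w | E (f w, g w)])%E.
Proof.
move=> mE mA PA posA; rewrite prob_pair // lt_def integral_ge0 ?andbT //.
apply/eqP => I0.
have mh : measurable_fun setT (fun w => P [set w' | E (f w, g w')]).
  have -> : (fun w => P [set w' | E (f w, g w')]) =
      (distribution P g \o xsection E) \o f.
    apply/funext => w /=; rewrite /distribution /pushforward.
    by congr (P _); apply/seteqP; split => w' /=; rewrite /xsection /= inE.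
  by apply: measurableT_comp => //; exact: measurable_fun_xsection.
have : (\int[P]_w `|P [set w' | E (f w, g w')]|)%E = 0%E.
  by rewrite -[RHS]I0; apply: eq_integral => w _; rewrite gee0_abs.
move=> /(ae_eq_integral_abs P measurableT mh)[N [mN PN subN]].
suff : (P A <= P N)%E by rewrite PN leNgt PA.
apply: le_measure; rewrite ?inE // => w /posA pw; apply: subN => /= /(_ I) e.
by rewrite e ltxx in pw.
Qed.

Lemma Rintegral_pair (phi : S -> V -> R) :
  measurable_fun setT (fun sv : S * V => phi sv.1 sv.2) ->
  (forall s, P.-integrable setT (EFin \o (fun w => phi s (g w)))) ->
  P.-integrable setT (EFin \o (fun w => phi (f w) (g w))) ->
  P.-integrable setT (EFin \o (fun w => \int[P]_w' phi (f w) (g w'))%R) /\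
  (\int[P]_w (\int[P]_w' phi (f w) (g w')) = \int[P]_w phi (f w) (g w))%R.
Proof.
move=> mphi isec iphi.
pose F := fun sv : S * V => (phi sv.1 sv.2)%:E.
have mF : measurable_fun setT F by exact/measurable_EFinP.
have iF : (distribution P f \x distribution P g)%E.-integrable setT F.
  apply/integrableP; split=> //.
  rewrite (eq_measure_integral (distribution P pair_mfun)); last first.
    by move=> A mA _; exact: pair_law.
  by have /integrableP[] := integrable_pushforward mpair mF iphi measurableT.
have secE s : fubini_F (distribution P g) F s = (\int[P]_w' phi s (g w'))%R%:E.
  rewrite /fubini_F integral_distribution; last exact: isec.
    by rewrite /Rintegral fineK //; exact: (integrable_fin_num measurableT (isec s)).
  exact: (measurableT_comp mF).
have iG := integrable_fubini_F iF.
have E1 := integral12_prod_meas1 iF.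
pose h s := (\int[P]_w' phi s (g w'))%R%:E.
have secEh : fubini_F (distribution P g) F = h by exact: (funext secE).
rewrite secEh in iG E1.
have [mh ih] := integrableP _ _ _ iG.
have iG' : P.-integrable setT (h \o f).
  apply/integrableP; split; first exact: measurableT_comp.
  move: ih; rewrite ge0_integral_distribution //.
  exact: measurableT_comp.
split=> //.
rewrite -[LHS]/(fine (\int[P]_w (h \o f) w)%E) -integral_distribution // E1.
rewrite (eq_measure_integral (distribution P pair_mfun)); last first.
  by move=> A mA _; exact: pair_law.
by rewrite integral_distribution.
Qed.

End IndependentPair.

(** * Sigma-algebras generated by random vectors *)

HB.instance Definition _ (R : realType) := isPointed.Build R[i] 0.

Section BorelVectors.
Variables (R : realType) (n : nat).
Local Notation CV := 'cV[R[i]]_n.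

Definition cvec_generators : set (set CV) :=
  \bigcup_(j in [set: 'I_n])
    (preimage_set_system setT (fun v : CV => complex.Re (v j 0)) measurable `|`
     preimage_set_system setT (fun v : CV => complex.Im (v j 0)) measurable).

Definition borelCV := g_sigma_algebraType cvec_generators.

Lemma borel_cvec_Re j (U : set R) : measurable U ->
  borel_cvec R n ((fun v : CV => complex.Re (v j 0)) @^-1` U).
Proof.
move=> mU; apply: sub_sigma_algebra; exists j => //; left.
by exists U => //; rewrite setTI.
Qed.

Lemma borel_cvec_Im j (U : set R) : measurable U ->
  borel_cvec R n ((fun v : CV => complex.Im (v j 0)) @^-1` U).
Proof.
move=> mU; apply: sub_sigma_algebra; exists j => //; right.
by exists U => //; rewrite setTI.
Qed.

Lemma cmeas_borelCV j : cmeas (fun v : borelCV => v j 0).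
Proof.
split=> _ U mU; rewrite setTI; [exact: borel_cvec_Re | exact: borel_cvec_Im].
Qed.

End BorelVectors.

Section Past.
Variables (R : realType) (d : measure_display) (T : measurableType d).
Variables (P : probability T R) (m n : nat) (r : 'I_m -> T -> 'cV[R[i]]_n).
Hypothesis r_random : forall i, random_vector (r i).
Hypothesis r_indep : independent_vectors P r.
Implicit Types (s : seq 'I_m) (i : 'I_m).

(** A generating family of the past that is closed under intersection, as is
    needed to extend independence from rectangles to the sigma-algebra. *)
Definition cylinders s : set (set T) :=
  [set B | exists2 A : 'I_m -> set 'cV[R[i]]_n,
     (forall i, borel_cvec R n (A i)) & B = \bigcap_(i in [set` s]) (r i @^-1` A i)].

(** The sample space with the information carried by the vectors [r i] for [i]
    in [s]. *)
Definition past s := g_sigma_algebraType (cylinders s).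

Lemma borel_cvecT : borel_cvec R n setT.
Proof. exact: (@measurableT _ (borelCV R n)). Qed.

Lemma borel_cvecI A B : borel_cvec R n A -> borel_cvec R n B -> borel_cvec R n (A `&` B).
Proof. exact: (@measurableI _ (borelCV R n)). Qed.

Lemma cylinders_sub s : cylinders s `<=` measurable.
Proof.
move=> _ [A mA ->]; apply: fin_bigcap_measurable => [|i _].
  exact: finite_seq.
exact: r_random.
Qed.

Lemma cylindersT s : cylinders s setT.
Proof.
exists (fun=> setT); first by move=> _; exact: borel_cvecT.
by rewrite bigcapT.
Qed.

Lemma cylinders_setI s : setI_closed (cylinders s).
Proof.
move=> _ _ [A mA ->] [B mB ->]; exists (fun i => A i `&` B i).
  by move=> i; exact: borel_cvecI.
by rewrite -bigcapI; apply: eq_bigcapr.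
Qed.

(** On cylinders this is the product rule of [independent_vectors]; two finite
    measures that agree on a generating family closed under intersection agree
    on the sigma-algebra. *)
Lemma past_indep s i A B : i \notin s -> <<s cylinders s >> A -> borel_cvec R n B ->
  P (A `&` r i @^-1` B) = (P A * P (r i @^-1` B))%E.
Proof.
move=> is_ sA mB; have mr : measurable (r i @^-1` B) by exact: r_random.
(* Both [A |-> P (A `&` r i @^-1` B)] and the multiple [c] of [P] are measures. *)
pose c := NngNum (fine_ge0 (measure_ge0 P (r i @^-1` B))).
have cE : (c%:num)%:E = P (r i @^-1` B).
  by rewrite /= fineK // fin_num_measure.
have := @g_sigma_algebra_measure_unique _ R T (cylinders s) (@cylinders_sub s)
  (fun=> setT) (fun=> cylindersT s) _ (mrestr P mr) (mscale c P).
rewrite bigcup_const // => /(_ erefl (@cylinders_setI s)) H.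
suff E : mrestr P mr A = mscale c P A.
  by move: E; rewrite /mrestr /mscale cE => ->; rewrite muleC.
apply: H sA => [_ [D mD ->]|_]; last first.
  exact: le_lt_trans (probability_le1 P (measurableI _ _ measurableT mr)) (ltry 1).
pose D' j := if j == i then B else D j.
have mD' j : borel_cvec R n (D' j) by rewrite /D'; case: ifP.
have Ds j : j \in s -> D' j = D j.
  by rewrite /D'; case: eqP => // -> js; rewrite js in is_.
have E1 : \bigcap_(j in [set` s]) (r j @^-1` D j) =
    \bigcap_(j in [set` [set j in s]%SET]) (r j @^-1` D' j).
  apply/seteqP; split => w wD j /= js.
    by rewrite inE in js; rewrite Ds //; exact: wD.
  by rewrite -Ds //; apply: wD; rewrite /= inE.
have E2 : (\bigcap_(j in [set` s]) (r j @^-1` D j)) `&` r i @^-1` B =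
    \bigcap_(j in [set` (i |: [set j in s])%SET]) (r j @^-1` D' j).
  apply/seteqP; split => w.
    move=> [wD wB] j /=; rewrite !inE => /orP[/eqP ->|js].
      by rewrite /D' eqxx.
    by rewrite Ds //; exact: wD.
  move=> wD; split.
    by move=> j /= js; rewrite -Ds //; apply: wD; rewrite /= !inE js orbT.
  by have := wD i; rewrite /= !inE eqxx /D' eqxx; apply.
transitivity (P (\bigcap_(j in [set` s]) (r j @^-1` D j) `&` r i @^-1` B)) => //.
transitivity (P (r i @^-1` B) * P (\bigcap_(j in [set` s]) (r j @^-1` D j)))%E; last first.
  by rewrite -cE.
rewrite E2 {1}E1 !r_indep // big_setU1 ?inE //=.
by rewrite {1}/D' eqxx.
Qed.

Lemma mpast_id s : measurable_fun setT (id : T -> past s).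
Proof.
move=> _ A mA; rewrite setTI; move: mA.
exact: (smallest_sub (@sigma_algebra_measurable _ T) (@cylinders_sub s)).
Qed.

Lemma mborel_r i : measurable_fun setT (r i : T -> borelCV R n).
Proof. by move=> _ A mA; rewrite setTI; exact: r_random. Qed.

Lemma cmeas_past s i j : i \in s -> cmeas (fun w : past s => r i w j 0).
Proof.
move=> is_.
have H B : borel_cvec R n B -> (measurable : set (set (past s))) (r i @^-1` B).
  move=> mB; apply: sub_sigma_algebra.
  exists (fun l => if l == i then B else setT).
    by move=> l; case: ifP => // _; exact: borel_cvecT.
  apply/seteqP; split => w.
    by move=> wB l _ /=; case: eqP => // ->.
  by move=> /(_ i is_) /=; rewrite eqxx.
by split=> _ U mU; rewrite setTI;
  [exact: (H _ (borel_cvec_Re j mU)) | exact: (H _ (borel_cvec_Im j mU))].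
Qed.

Lemma cmeas_r i j : cmeas (fun w => r i w j 0).
Proof.
by split=> _ U mU; rewrite setTI;
  [exact: (r_random i (borel_cvec_Re j mU)) | exact: (r_random i (borel_cvec_Im j mU))].
Qed.

Let past_mixin s := isMeasurableFun.Build _ _ _ _ _ (@mpast_id s).
Definition past_fun s : {mfun T >-> past s} := HB.pack (id : T -> past s) (past_mixin s).

Let r_mixin i := isMeasurableFun.Build _ _ _ _ _ (@mborel_r i).
Definition r_fun i : {mfun T >-> borelCV R n} := HB.pack (r i : T -> borelCV R n) (r_mixin i).

End Past.

(** * The expected characteristic polynomial *)

Lemma Re_sum (R : realType) I (s : seq I) (Q : pred I) (F : I -> R[i]) :
  complex.Re (\sum_(i <- s | Q i) F i) = \sum_(i <- s | Q i) complex.Re (F i).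
Proof. by elim/big_rec2: _ => // i x y _ <-; case: (F i) y => ? ? []. Qed.

Section OuterSums.
Local Open Scope sesquilinear_scope.
Variables (R : realType) (n : nat) (I : eqType).
Implicit Types (s : seq I) (b : bool) (c : R).

Definition outer_sum (v : I -> 'cV[R[i]]_n) s := \sum_(i <- s) outer (v i).

Lemma outer_sum_cons v i s : outer_sum v (i :: s) = outer_sum v s + outer (v i).
Proof. by rewrite /outer_sum big_cons addrC. Qed.

Lemma outer_sum_rcons v s i : outer_sum v (rcons s i) = outer_sum v s + outer (v i).
Proof. by rewrite /outer_sum -cats1 big_cat big_seq1. Qed.

Lemma outer_sum_nil v : outer_sum v [::] = 0.
Proof. by rewrite /outer_sum big_nil. Qed.

Lemma outer_sum_herm v s : (outer_sum v s)^t* = outer_sum v s.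
Proof.
elim: s => [|i s IH]; first by rewrite outer_sum_nil trmx0 map_mx0.
by rewrite outer_sum_cons herm_add_outer.
Qed.

Variables (d : measure_display) (S : measurableType d) (Y : S -> I -> 'cV[R[i]]_n).

Lemma cmeas_outer_sum s : {in s, forall i j, cmeas (fun x => Y x i j 0)} ->
  forall a e, cmeas (fun x => outer_sum (Y x) s a e).
Proof.
elim: s => [|i s IH] mY a e.
  apply: (@eq_cmeas _ _ _ (fun=> 0)); last exact: cmeas_cst.
  by move=> x; rewrite outer_sum_nil mxE.
apply: (@eq_cmeas _ _ _ (fun x => (outer_sum (Y x) s + outer (Y x i)) a e)).
  by move=> x; rewrite outer_sum_cons.
apply: cmeas_add_outer => [|j]; last by apply: mY; rewrite mem_head.
by apply: IH => l ls; apply: mY; rewrite inE ls orbT.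
Qed.

(** Starting from the constant root count of [F 0], the terms are added one at a
    time. *)
Lemma measurable_nroots_outer_sum F s b c : admissible F ->
  {in s, forall i j, cmeas (fun x => Y x i j 0)} ->
  forall k, measurable [set x | nroots b c (F (outer_sum (Y x) s)) = k].
Proof.
move=> aF; elim: s => [|i s IH] mY k.
  have -> : [set x | nroots b c (F (outer_sum (Y x) [::])) = k] =
            [set x | nroots b c (F 0) = k].
    by apply/seteqP; split => x /=; rewrite outer_sum_nil.
  case: (eqVneq (nroots b c (F 0)) k) => [e|/eqP ne].
    by rewrite (_ : [set x | _] = setT) //; apply/seteqP; split.
  by rewrite (_ : [set x | _] = set0) //; apply/seteqP; split.
have mYs : {in s, forall i j, cmeas (fun x => Y x i j 0)}.
  by move=> l ls; apply: mY; rewrite inE ls orbT.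
have -> : [set x | nroots b c (F (outer_sum (Y x) (i :: s))) = k] =
          [set x | nroots b c (F (outer_sum (Y x) s + outer (Y x i))) = k].
  by apply/seteqP; split => x /=; rewrite outer_sum_cons.
apply: measurable_nroots_add_outer => //.
- by move=> x; exact: outer_sum_herm.
- exact: cmeas_outer_sum.
- by move=> j; apply: mY; rewrite mem_head.
- exact: IH.
Qed.

End OuterSums.

Section ExpectedCharPoly.
Variables (R : realType) (d : measure_display) (T : measurableType d).
Variables (P : probability T R) (m n : nat) (r : 'I_m -> T -> 'cV[R[i]]_n).
Hypothesis r_random : forall i, random_vector (r i).
Hypothesis r_indep : independent_vectors P r.
Implicit Types (s : seq 'I_m) (b : bool) (c : R).

Let X s w := outer_sum (fun i => r i w) s.

Hypothesis char_int : poly_integrable P (fun w => char_poly (X (enum 'I_m) w)).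

(** The coefficient of degree [n - 1] of the characteristic polynomial is minus
    the trace, that is minus the sum of all [|r i|^2]. *)
Lemma second_moment i : P.-integrable setT (EFin \o (fun w => sqnorm (r i w))).
Proof.
have msq : measurable_fun setT (fun w => sqnorm (r i w)).
  apply: measurable_sum => a; have [m1 m2] := cmeas_r r_random i a.
  by apply: measurable_funD; apply: measurable_funX.
(* For [n = 0] there is no coefficient of degree [n - 1], but the norm is zero. *)
case: (posnP n) => [n0|n0].
  apply: (integrable_of_bound msq (finite_measure_integrable_cst P 0 measurableT)) => w.
  by rewrite /sqnorm big1 ?normr0 // => a; move: (ltn_ord a); rewrite {2}n0.
have [iR _] := complex_integrableZ (-1) (char_int n.-1).
apply: (integrable_of_bound msq iR) => w.
rewrite ger0_norm ?sqnorm_ge0 // char_poly_trace // mulN1r opprK.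
have tr v : complex.Re (\tr (outer v)) = sqnorm v.
  rewrite /mxtrace /sqnorm Re_sum; apply: eq_bigr => a _.
  by rewrite outerE; case: (v a 0) => x y /=; ring.
have -> : complex.Re (\tr (X (enum 'I_m) w)) = \sum_(l <- enum 'I_m) sqnorm (r l w).
  rewrite /X /outer_sum (big_morph _ (@mxtraceD _ n) (@mxtrace0 _ n)) Re_sum.
  by apply: eq_bigr => l _; rewrite tr.
rewrite (bigD1_seq i) ?mem_enum ?enum_uniq //= lerDl.
by apply: sumr_ge0 => l _; exact: sqnorm_ge0.
Qed.

(** One vector is averaged at a time; by independence this is the expected
    characteristic polynomial of [C] plus the rank-one terms indexed by [s]. *)
Definition mean_char_poly s := foldr (fun i F => average P (r i) F) (@char_poly _ n) s.

Lemma admissible_mean s : admissible (mean_char_poly s).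
Proof.
elim: s => [|i s IH] /=; first exact: admissible_char_poly.
apply: admissible_average => //; first exact: cmeas_r.
exact: second_moment.
Qed.

Lemma cmeas_fst d1 d2 (S : measurableType d1) (V : measurableType d2) (Z : S -> R[i]) :
  cmeas Z -> cmeas (fun sv : S * V => Z sv.1).
Proof. by move=> [m1 m2]; split; [exact: (measurableT_comp m1)|exact: (measurableT_comp m2)]. Qed.

Lemma cmeas_snd d1 d2 (S : measurableType d1) (V : measurableType d2) (Z : V -> R[i]) :
  cmeas Z -> cmeas (fun sv : S * V => Z sv.2).
Proof. by move=> [m1 m2]; split; [exact: (measurableT_comp m1)|exact: (measurableT_comp m2)]. Qed.

Section Step.
Variables (s1 : seq 'I_m) (i : 'I_m).
Hypothesis is1 : i \notin s1.

Local Notation S := (past r s1).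
Local Notation V := (borelCV R n).
Let f := past_fun r_random s1.
Let g := r_fun r_random i.

Let fg_indep A B : measurable A -> measurable B ->
  P (f @^-1` A `&` g @^-1` B) = (P (f @^-1` A) * P (g @^-1` B))%E.
Proof. by move=> mA mB; exact: (past_indep r_random r_indep is1). Qed.

Let Zsum (sv : S * V) := outer_sum (fun l => r l sv.1) s1.

Let cmeas_Zsum a e : cmeas (fun sv => Zsum sv a e).
Proof.
apply: cmeas_outer_sum => l ls j.
exact: (@cmeas_fst _ _ S V (fun w => r l w j 0) (cmeas_past r j ls)).
Qed.

Let cmeas_v j : cmeas (fun sv : S * V => sv.2 j 0).
Proof. exact: (@cmeas_snd _ _ S V (fun v => v j 0) (cmeas_borelCV R j)). Qed.

(** Replaces a random vector by its conditional average given the vectors already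
    drawn. *)
Lemma average_step F k : admissible F ->
  complex_integrable P (fun w => (F (X s1 w + outer (r i w)))`_k) ->
  complex_integrable P (fun w => (average P (r i) F (X s1 w))`_k) /\
  complex_expectation P (fun w => (average P (r i) F (X s1 w))`_k) =
  complex_expectation P (fun w => (F (X s1 w + outer (r i w)))`_k).
Proof.
move=> aF [iR iI].
have mF : cmeas (fun sv : S * V => (F (Zsum sv + outer sv.2))`_k).
  by apply: (adm_tame aF k).2; exact: cmeas_add_outer.
have sec (t : T) := admissible_integrable (cmeas_r r_random i) (second_moment i)
  (outer_sum (fun l => r l t) s1) aF k.
pose Z w w' := (F (X s1 w + outer (r i w')))`_k.
have [iR' eR] : P.-integrable setT (EFin \o (fun w => \int[P]_w' complex.Re (Z w w'))%R) /\
    (\int[P]_w \int[P]_w' complex.Re (Z w w') = \int[P]_w complex.Re (Z w w))%R.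
  exact: (@Rintegral_pair _ _ _ _ _ S V P f g fg_indep
    (fun t v => complex.Re (F (outer_sum (fun l => r l t) s1 + outer v))`_k)
    mF.1 (fun t => (sec t).1) iR).
have [iI' eI] : P.-integrable setT (EFin \o (fun w => \int[P]_w' complex.Im (Z w w'))%R) /\
    (\int[P]_w \int[P]_w' complex.Im (Z w w') = \int[P]_w complex.Im (Z w w))%R.
  exact: (@Rintegral_pair _ _ _ _ _ S V P f g fg_indep
    (fun t v => complex.Im (F (outer_sum (fun l => r l t) s1 + outer v))`_k)
    mF.2 (fun t => (sec t).2) iI).
have -> : (fun w => (average P (r i) F (X s1 w))`_k) =
   (fun w => (\int[P]_w' complex.Re (Z w w'))%R +i* (\int[P]_w' complex.Im (Z w w'))%R).
  by apply/funext => w; rewrite coef_average // complex_expectationE.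
split; first by split.
by rewrite complex_expectationE /= eR eI [RHS]complex_expectationE.
Qed.

(** For each outcome of the vectors already drawn, [prob_nroots_average] provides
    a set of positive probability for the next one; Fubini assembles them. *)
Lemma nroots_step F (b : bool) (c : R) k : admissible F ->
  (0 < P [set w | nroots b c (average P (r i) F (X s1 w)) = k])%E ->
  (0 < P [set w | nroots b c (F (X s1 w + outer (r i w))%R) = k])%E.
Proof.
move=> aF posA.
have aA : admissible (average P (r i) F).
  by apply: admissible_average => //; [exact: cmeas_r|exact: second_moment].
pose E := [set sv : S * V | nroots b c (F (Zsum sv + outer sv.2)) = k].
have mE : measurable E.
  apply: measurable_nroots_add_outer => //.
    by move=> sv; exact: outer_sum_herm.
  apply: measurable_nroots_outer_sum => // l ls j.
  exact: (@cmeas_fst _ _ S V (fun w => r l w j 0) (cmeas_past r j ls)).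
apply: (@prob_pair_gt0 _ _ _ _ _ S V P f g fg_indep E _ mE _ posA).
  by apply: measurable_nroots_outer_sum => // l ls j; exact: cmeas_r.
move=> w /= kw.
suff : (0 < P [set w' | nroots b c (F (X s1 w + outer (r i w'))%R) = k])%E by [].
rewrite -kw; apply: prob_nroots_average => //; [exact: cmeas_r|exact: second_moment|].
exact: outer_sum_herm.
Qed.

End Step.

Lemma X_rcons s i w : X (rcons s i) w = X s w + outer (r i w).
Proof. exact: outer_sum_rcons. Qed.

Lemma split_notin s1 i s2 : s1 ++ i :: s2 = enum 'I_m -> i \notin s1.
Proof.
move=> e; have := enum_uniq 'I_m; rewrite -e cat_uniq => /and3P[_ + _].
by rewrite /= negb_or => /andP[].
Qed.

(** The terms are integrated out from the last to the first. *)
Lemma mean_char_poly_expectation s2 s1 : s1 ++ s2 = enum 'I_m ->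
  poly_integrable P (fun w => mean_char_poly s2 (X s1 w)) /\
  forall k, complex_expectation P (fun w => (mean_char_poly s2 (X s1 w))`_k) =
            complex_expectation P (fun w => (char_poly (X (enum 'I_m) w))`_k).
Proof.
elim: s2 s1 => [|i s2 IH] s1; first by rewrite cats0 => ->; split.
move=> e; have is1 := split_notin e.
have [int2 E2] := IH (rcons s1 i) (etrans (cat_rcons _ _ _) e).
have step k := @average_step s1 i is1 (mean_char_poly s2) k (admissible_mean s2).
have intk k : complex_integrable P (fun w => (mean_char_poly s2 (X s1 w + outer (r i w)))`_k).
  by apply: eq_complex_integrable (int2 k) => w; rewrite X_rcons.
split=> k /=; have [i1 e1] := step k (intk k); first exact: i1.
rewrite e1 -E2; congr complex_expectation; apply/funext => w.
by rewrite X_rcons.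
Qed.

Lemma poly_expectation_mean :
  poly_expectation P n (fun w => char_poly (X (enum 'I_m) w)) =
  mean_char_poly (enum 'I_m) 0.
Proof.
have [_ E] := @mean_char_poly_expectation (enum 'I_m) [::] erefl.
have sz := adm_size (admissible_mean (enum 'I_m)) 0.
apply/polyP => k; rewrite coef_poly; case: ltnP => nk; last by rewrite nth_default ?sz.
rewrite -E -[RHS](complex_expectation_cst P); congr complex_expectation.
by apply/funext => w; rewrite /X outer_sum_nil.
Qed.

(** The vectors are drawn from the first to the last, each time keeping the root
    count of the conditional mean with positive probability. *)
Lemma prob_nroots_mean b c s1 s2 : s1 ++ s2 = enum 'I_m ->
  (0 < P [set w | nroots b c (mean_char_poly s2 (X s1 w)) =
     nroots b c (mean_char_poly (enum 'I_m) 0)])%E.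
Proof.
elim/last_ind: s1 s2 => [|s1 i IH] s2.
  move=> /= ->; rewrite (_ : [set _ | _] = setT) ?probability_setT ?lte01 //.
  by apply/seteqP; split => w //= _; rewrite /X outer_sum_nil.
rewrite cat_rcons => e.
have := nroots_step (split_notin e) (admissible_mean s2) (IH _ e).
congr (0 < P _)%E; apply/seteqP; split => w /=; by rewrite X_rcons.
Qed.

Lemma measurable_nroots_char_poly b c (Q : set nat) :
  measurable [set w | Q (nroots b c (char_poly (X (enum 'I_m) w)))].
Proof.
have -> : [set w | Q (nroots b c (char_poly (X (enum 'I_m) w)))] =
    \bigcup_(k in Q) [set w | nroots b c (char_poly (X (enum 'I_m) w)) = k].
  by apply/seteqP; split => [w Qw|w [k Qk /= ->]] //; exists (nroots b c (char_poly (X (enum 'I_m) w))).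
apply: bigcup_measurable => k _; apply: measurable_nroots_outer_sum.
  exact: admissible_char_poly.
by move=> i _ j; exact: cmeas_r.
Qed.

Let q := mean_char_poly (enum 'I_m) 0.

Lemma eigenvalue_rank_prob k b : (1 <= k <= n)%N ->
  (0 < P [set w | above b (root_rank k q) (eigenvalue_rank k (X (enum 'I_m) w)) =
                  above b (root_rank k q) (root_rank k q)])%E.
Proof.
move=> kn; set c := root_rank k q.
have aq := admissible_mean (enum 'I_m).
have Hq : above b c c = (k <= nroots b c q)%N.
  by apply: above_root_rank; [exact: (adm_monic aq)|rewrite (adm_size aq)].
have HM w : above b c (eigenvalue_rank k (X (enum 'I_m) w)) =
    (k <= nroots b c (char_poly (X (enum 'I_m) w)))%N.
  by apply: above_root_rank; [exact: char_poly_monic|rewrite size_char_poly].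
have -> : [set w | above b c (eigenvalue_rank k (X (enum 'I_m) w)) = above b c c] =
   [set w | (k <= nroots b c (char_poly (X (enum 'I_m) w)))%N = (k <= nroots b c q)%N].
  by apply/seteqP; split => w /=; rewrite Hq HM.
apply: lt_le_trans (@prob_nroots_mean b c (enum 'I_m) [::] (cats0 _)) _.
apply: le_measure; rewrite ?inE.
- exact: (@measurable_nroots_char_poly b c [set j | j = nroots b c q]).
- exact: (@measurable_nroots_char_poly b c [set j | (k <= j)%N = (k <= nroots b c q)%N]).
- by move=> w /= ->.
Qed.

End ExpectedCharPoly.

Theorem theorem1p7 (R : realType) (d : measure_display) (T : measurableType d)
    (P : probability T R) (m n : nat) (r : 'I_m -> T -> 'cV[R[i]]_n)
    (r_random : forall i, random_vector (r i))
    (r_indep : independent_vectors P r) :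
  let M : T -> 'M[R[i]]_n := fun w => sum_outer (fun i => r i w) in
  let q : {poly R[i]} := poly_expectation P n (fun w => char_poly (M w)) in
  poly_integrable P (fun w => char_poly (M w)) ->
  real_rooted q /\
  forall k : nat, (1 <= k <= n)%N ->
    (0 < P [set w | eigenvalue_rank k (M w) <= root_rank k q]%R)%E /\
    (0 < P [set w | eigenvalue_rank k (M w) >= root_rank k q]%R)%E.
Proof.
move=> M.
have -> : M = (fun w => outer_sum (fun i => r i w) (enum 'I_m)).
  by apply/funext => w; rewrite /outer_sum big_enum.
move=> q char_int; have qE := poly_expectation_mean r_random r_indep char_int.
rewrite -/q in qE.
have aq := admissible_mean r_random char_int (enum 'I_m).
split.
  by rewrite qE; apply: admissible_real_rooted => //; rewrite trmx0 map_mx0.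
move=> k kn; rewrite qE.
have H b := eigenvalue_rank_prob r_random r_indep char_int b kn.
split.
  have := H false; congr (0 < P _)%E; apply/seteqP; split => w /=;
    rewrite /above ltxx; last by move/le_gtF.
  by move=> /negbT; rewrite -leNgt.
have := H true; congr (0 < P _)%E; apply/seteqP; split => w /=;
  by rewrite /above lexx.
Qed.
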